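(* The values $\{\widetilde{\eta}^{(n)}\}_{n\ge 0}$ are algebraically independent over $\overline{\mathbb{Q}}$, implying that $\widetilde{\eta}^{(n)}$ is transcendental for all integers $n\ge 0$.
   Context: For integers $n\ge 0$, the generalized non-alternating Eta constants are $$\widetilde{\eta}^{(n)}=-n!\sum_{k=1}^{\infty}\frac{1}{k^n\cdot k!}.$$ $\overline{\mathbb{Q}}$ denotes the field of algebraic numbers. Algebraic independence of the infinite family means that every finite subfamily is algebraically independent. *)

(* Defs.v *)
From mathcomp Require Import all_boot all_order all_algebra.
From mathcomp Require Import reals topology normedtype sequences.
From mathcomp Require Import complex.
From mathcomp Require Import -(notations) mpoly.

Set Implicit Arguments.
Unset Strict Implicit.
Unset Printing Implicit Defensive.

Import Order.TTheory GRing.Theory Num.Theory.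
Import numFieldNormedType.Exports.

Local Open Scope ring_scope.

Definition algebraic_number (L : numFieldType) (z : L) : Prop :=
  algebraicOver (ratr : rat -> L) z.

Definition transcendental (L : numFieldType) (z : L) : Prop :=
  ~ algebraic_number z.

(* The subfield of coefficients is given by its membership predicate [K].
   The notations of the multivariate polynomial library clash with those of the
   analysis library: [mpoly m L] is {mpoly L[m]}, [mcoeff u p] is p@_u and
   [meval v p] is p.@[v]. *)
Definition algebraically_independent (L : fieldType) (K : L -> Prop)
    (m : nat) (v : 'I_m -> L) : Prop :=
  forall p : mpoly m L,
    (forall u, K (mcoeff u p)) -> meval v p = 0 -> p = 0.

Definition algebraically_independent_family (L : fieldType) (K : L -> Prop)
    (I : Type) (x : I -> L) : Prop :=
  forall (m : nat) (s : 'I_m -> I), injective s ->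
    algebraically_independent K (fun j => x (s j)).

Definition eta_tilde (R : realType) (n : nat) : R :=
  - (n`!%:R
     * limn (fun N : nat => \sum_(1 <= k < N) (k%:R ^+ n * k`!%:R : R)^-1)).

(* Main.v *)
(** Siegel's method. With [F_0 = exp z] and [F_j = sum_(k > 0) z^k / (k^j k!)] one has,
    for [theta = z d/dz], [theta F_0 = z F_0], [theta F_1 = F_0 - 1] and
    [theta F_(j+1) = F_j]; hence the monomials of bounded degree in the [F_j] solve a
    linear system [theta y_a = k_a z y_a + sum_b N_ab y_b] with [N] a strictly triangular
    matrix of integers. Siegel's lemma gives a form [L = sum_a P_a(z) y_a] with small
    integer coefficients and a high order zero at 0.

    Shidlovskii's lemma is elementary here: a nonzero subspace of forms over the field of
    rational functions that is stable under differentiation contains a form with constant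
    coefficients, because the ratios of the coefficients of a form with minimal leading
    monomial solve [theta c = k z c + m], whose rational solutions are constant. That
    constant form is a multiple of [exp(kz)], which does not vanish at 0; Cramer's rule
    then bounds the order of [L] at 0 unless its first derivatives are independent. Thus
    enough derivatives of [L] stay independent at [z = 1], and an integer relation between
    the [y_a(1)], completed by these small forms, would give a nonzero integer determinant
    of absolute value less than 1.

    Algebraic coefficients are reduced to rational ones by taking the norm of a relation. *)
Require Import Defs.
From mathcomp Require Import all_boot all_order all_algebra.
From mathcomp Require Import fingroup perm.
From mathcomp Require Import boolp classical_sets functions reals topology normedtype sequences.
From mathcomp Require Import complex.
From mathcomp Require Import -(notations) mpoly.
From mathcomp Require Import ring zify.

Set Implicit Arguments.
Unset Strict Implicit.
Unset Printing Implicit Defensive.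

(** * Arithmetic and counting *)

(** By Legendre's formula the exponent of [p] in the binomial is a sum of nonnegative differences of
    quotients by [p ^ i], and the one at [i = v] is at least 1. *)
Lemma prime_dvd_central_bin p v m :
  prime p -> 0 < v -> m < p ^ v <= m.*2 -> p %| 'C(m.*2, m).
Proof.
move=> p_pr v_gt0 /andP[lt_m_pv le_pv_2m].
have p_gt1 := prime_gt1 p_pr.
have C_gt0 : 0 < 'C(m.*2, m) by rewrite bin_gt0 -addnn leq_addr.
rewrite -[X in X %| _]expn1 pfactor_dvdn //.
have le_v_2m : v <= m.*2.
  by apply: leq_trans (ltnW (ltn_expl v p_gt1)) le_pv_2m.
(* The terms with [i > m] vanish; adding them gives both Legendre sums the same range. *)
have logm : logn p m`! = \sum_(1 <= i < m.*2.+1) m %/ p ^ i.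
  rewrite logn_fact // [RHS](@big_cat_nat _ _ _ m.+1) //=; last by rewrite ltnS -addnn leq_addr.
  rewrite -[LHS]addn0; congr (_ + _); apply/esym; rewrite big_nat_cond big1 // => i /andP[/andP[lt_mi _] _].
  by rewrite divn_small // (ltn_trans lt_mi) // ltn_expl.
have /(congr1 (logn p)) : 'C(m.*2, m) * (m`! * m`!) = m.*2`!.
  by rewrite -(@bin_fact m.*2 m) ?leq_addr -?addnn ?addnK // leq_addr.
rewrite !lognM ?muln_gt0 ?fact_gt0 //= logm logn_fact // => eqL.
rewrite -(ltn_add2r (logn p m`! + logn p m`!)) logm add0n eqL -big_split /=.
have v_in : v \in index_iota 1 m.*2.+1 by rewrite mem_index_iota v_gt0.
rewrite (big_rem v) //= [ltnRHS](big_rem v) //= -addSn leq_add //; last first.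
  apply: leq_sum => i _.
  rewrite addnn -[m.*2]muln2 -[X in X <= _]muln2 leq_divRL ?expn_gt0 ?(ltnW p_gt1) //.
  by rewrite mulnAC leq_mul2r leq_divM orbT.
by rewrite divn_small // divn_gt0 // expn_gt0 (ltnW p_gt1).
Qed.

(** Let [p ^ v] be the exact power of [p] in [k]. If it is at most [m], it divides [d]; otherwise
    [p ^ (v - 1)] divides [d] and the binomial supplies the missing factor [p]. *)
Lemma dvd_mul_central_bin m d :
  0 < d -> (forall k, 0 < k <= m -> k %| d) ->
  forall k, 0 < k <= m.*2 -> k %| d * 'C(m.*2, m).
Proof.
move=> d_gt0 dvd_d k /andP[k_gt0 le_k2m].
have C_gt0 : 0 < 'C(m.*2, m) by rewrite bin_gt0 -addnn leq_addr.
apply/(dvdn_partP _ k_gt0) => p; rewrite mem_primes => /and3P[p_pr _ _].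
rewrite p_part; set v := logn p k.
have p_gt1 := prime_gt1 p_pr.
have le_pv : p ^ v <= m.*2.
  by apply: leq_trans le_k2m; apply: dvdn_leq => //; apply: pfactor_dvdnn.
have [le_pv_m|lt_m_pv] := leqP (p ^ v) m.
  by apply: dvdn_mulr; apply: dvd_d; rewrite le_pv_m expn_gt0 (ltnW p_gt1).
case: v le_pv lt_m_pv => [|v] le_pv lt_m_pv; first by rewrite expn0 dvd1n.
rewrite expnSr; apply: dvdn_mul; last first.
  by apply: (@prime_dvd_central_bin p v.+1); rewrite ?lt_m_pv.
apply: dvd_d; rewrite expn_gt0 (ltnW p_gt1) /=.
rewrite -leq_double; apply: leq_trans le_pv.
by rewrite expnS -mul2n leq_mul2r p_gt1 orbT.
Qed.

Lemma leq_bin_exp2 n k : 'C(n, k) <= 2 ^ n.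
Proof.
have [lt_nk|le_kn] := ltnP n k; first by rewrite bin_small.
have := expnDn 1 1 n; rewrite addn1 => ->.
by rewrite (bigD1 (Ordinal (le_kn : k < n.+1))) //= !exp1n !muln1 leq_addr.
Qed.

Lemma leq_double_self n : n <= n.*2.
Proof. by rewrite -addnn leq_addr. Qed.

(* Doubling: a common multiple of [1..m] times ['C(2m, m)] is one of [1..2m]. *)
Lemma exists_small_common_multiple T :
  exists2 d, 0 < d <= 16 ^ T & forall k, 0 < k <= T -> k %| d.
Proof.
have pow2 e : exists2 d, 0 < d <= 4 ^ (2 ^ e) & forall k, 0 < k <= 2 ^ e -> k %| d.
  elim: e => [|e [d /andP[d_gt0 d_le] dP]].
    by exists 1 => // k /andP[k_gt0 k_le]; case: k k_gt0 k_le => [|[]].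
  exists (d * 'C((2 ^ e).*2, 2 ^ e)).
    rewrite muln_gt0 d_gt0 bin_gt0 leq_double_self /=.
    rewrite expnS mul2n -[X in 4 ^ X]addnn expnD leq_mul //.
    apply: (@leq_trans (2 ^ (2 ^ e).*2)); last by rewrite -mul2n expnM.
    exact: leq_bin_exp2.
  by move=> k; rewrite expnS mul2n => k_le; apply: dvd_mul_central_bin.
case: T => [|T].
  by exists 1 => // k /andP[k_gt0 k_le]; case: k k_gt0 k_le.
(* The least power of 2 not below [T.+1] is less than twice that number, and
   [4 ^ (2 * T.+1) = 16 ^ T.+1]. *)
have [d /andP[d_gt0 d_le] dP] := pow2 (up_log 2 T.+1).
exists d.
  rewrite d_gt0 (leq_trans d_le) // -(expnM 4 2) leq_exp2l //.
  case: T {d d_gt0 d_le dP} => // T.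
  have -> : up_log 2 T.+2 = (up_log 2 T.+2).-1.+1.
    by rewrite prednK // up_log_gt0.
  by rewrite expnS leq_mul2l /= ltnW // up_log_gtn.
move=> k /andP[k_gt0 k_le]; apply: dP; rewrite k_gt0 (leq_trans k_le) //.
by rewrite up_logP.
Qed.

(** The product [(t + 1) ... (t + i)] dominates [t ^ i] and is [i!] times a binomial coefficient.
    This bound takes the place of Stirling's formula throughout. *)
Lemma expn_le_fact t i : t ^ i <= i`! * 2 ^ (i + t).
Proof.
apply: (@leq_trans (i`! * 'C(t + i, i))).
  rewrite mulnC bin_ffact; elim: i => // i IHi.
  rewrite expnS addnS ffactnS /= leq_mul //.
  by rewrite ltnW // ltnS leq_addr.
rewrite leq_pmul2l ?fact_gt0 // addnC.
exact: leq_bin_exp2.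
Qed.

Lemma fact_le_expn n : n`! <= n ^ n.
Proof.
have H k m : k <= m -> k`! <= m ^ k.
  elim: k => // k IHk lt_km; rewrite factS expnS leq_mul // IHk //; exact: ltnW.
exact: H.
Qed.

(** * Growth of order [n ^ (a n)], up to factors [A ^ n] and [n ^ c] *)

Definition ngrowth (a : nat) (g : nat -> nat) :=
  exists A c, forall n, 0 < n -> g n <= A ^ n * n ^ (a * n + c).

Lemma ngrowth_le a g h : (forall n, 0 < n -> g n <= h n) -> ngrowth a h -> ngrowth a g.
Proof.
move=> gh [A [c hP]]; exists A, c => n n0.
by apply: leq_trans (gh n n0) (hP n n0).
Qed.

Lemma ngrowth_wide a g :
  ngrowth a g -> exists A c, 0 < A /\ forall n, 0 < n -> g n <= A ^ n * n ^ (a * n + c).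
Proof.
move=> [A [c gP]]; exists A.+1, c; split => // n n0.
by apply: leq_trans (gP n n0) _; rewrite leq_mul2r leq_exp2r // leqnSn orbT.
Qed.

Lemma ngrowth_const C : ngrowth 0 (fun=> C).
Proof.
exists C, 0 => n n0; rewrite muln1.
case: C => // C; by rewrite -[X in X <= _]expn1 leq_pexp2l.
Qed.

Lemma ngrowth_id : ngrowth 0 id.
Proof. by exists 1, 1 => n n0; rewrite exp1n mul1n mul0n. Qed.

Lemma ngrowth_exp C b c : ngrowth 0 (fun n => C ^ (b * n + c)).
Proof.
exists (C ^ b * C.+1 ^ c), 0 => n n0; rewrite muln1.
rewrite expnD expnMn -expnM leq_mul //.
case: c => [|c]; first by rewrite !expn0 exp1n.
apply: (@leq_trans (C.+1 ^ c.+1)); first by rewrite leq_exp2r.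
by rewrite -[X in X <= _]expn1 leq_pexp2l // expn_gt0.
Qed.

Lemma ngrowthM a b g h : ngrowth a g -> ngrowth b h -> ngrowth (a + b) (fun n => g n * h n).
Proof.
move=> [A [c gP]] [B [d hP]]; exists (A * B), (c + d) => n n0.
apply: leq_trans (leq_mul (gP n n0) (hP n n0)) _.
by rewrite mulnACA -expnD -expnMn addnACA -mulnDl.
Qed.

Lemma ngrowthX a g k : ngrowth a g -> ngrowth (k * a) (fun n => g n ^ k).
Proof.
move=> gP; elim: k => [|k IHk].
  by rewrite mul0n; apply: ngrowth_le (ngrowth_const 1).
rewrite mulSn; apply: ngrowth_le (ngrowthM gP IHk) => n _.
by rewrite expnS.
Qed.

Lemma ngrowth_lin_exp C b c : ngrowth b (fun n => (C * n) ^ (b * n + c)).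
Proof.
have gn : ngrowth b (fun n => n ^ (b * n + c)) by exists 1, c => n _; rewrite exp1n mul1n.
apply: ngrowth_le (ngrowthM (ngrowth_exp C b c) gn) => n _.
by rewrite expnMn.
Qed.

Lemma ngrowth_fact b c : ngrowth b (fun n => (b * n + c)`!).
Proof.
apply: ngrowth_le (ngrowth_lin_exp (b + c) b c) => n n0.
apply: leq_trans (fact_le_expn _) _.
have [->//|k0] := posnP (b * n + c).
rewrite leq_exp2r // mulnDl leq_add2l; exact: leq_pmulr.
Qed.

(** Since [n ^ c <= c! * 2 ^ (n + c)], [g n] is at most [K ^ n * n ^ (a n)] with [K] independent of
    [n]; any [n > K] gives the strict bound. *)
Lemma ngrowth_beaten a g n0 :
  ngrowth a g -> exists2 n, n0 <= n & (0 < n) && (g n < n ^ (a.+1 * n)).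
Proof.
move=> /ngrowth_wide[A [c [A0 gP]]].
pose C := c`! * 2 ^ c.
have C0 : 0 < C by rewrite muln_gt0 fact_gt0 expn_gt0.
pose n := (n0 + A * 2 * C).+1.
exists n; first by rewrite /n; lia.
rewrite /=; apply: leq_ltn_trans (gP n _) _ => //.
rewrite mulSn !expnD mulnCA [ltnRHS]mulnC ltn_pmul2l ?expn_gt0 //.
apply: leq_ltn_trans (_ : (A * 2 * C) ^ n < _); last first.
  by rewrite ltn_exp2r // /n; lia.
rewrite (expnMn _ C) (expnMn A) -mulnA leq_pmul2l ?expn_gt0 ?A0 //.
apply: leq_trans (expn_le_fact n c) _.
rewrite expnD mulnA mulnC leq_pmul2l ?expn_gt0 // -/C.
by rewrite -{1}[C]expn1 leq_pexp2l.
Qed.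

Import Order.TTheory GRing.Theory Num.Theory.
Import numFieldNormedType.Exports.
Local Open Scope ring_scope.

(** Pigeonhole: the [h ^ #|I|] vectors with entries in [[0, h)] have images with entries in
    [[-K, K]], too few to be distinct; two vectors with the same image differ by a solution. *)
Lemma siegel_lemma (I J : finType) (B h : nat) (E : I -> J -> int) :
  (forall i j, `|E i j|%N <= B)%N ->
  ((2 * (#|I| * B * h)).+1 ^ #|J| < h ^ #|I|)%N ->
  exists x : I -> int, [/\ exists i, x i != 0, forall i, (`|x i|%N <= h)%N &
    forall j, \sum_i x i * E i j = 0].
Proof.
move=> EB lt_h.
set K := (#|I| * B * h)%N.
pose v (f : {ffun I -> 'I_h}) j : int := \sum_i (f i)%:Z * E i j.
have v_bound f j : (`|v f j| <= K%:Z)%R.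
  apply: le_trans (ler_norm_sum _ _ _) _.
  apply: (@le_trans _ _ (\sum_(i : I) (B * h)%N%:Z)).
    apply: ler_sum => i _; rewrite normrM [leLHS]mulrC PoszM.
    by apply: ler_pM => //; rewrite -abszE lez_nat // absz_nat ltnW.
  by rewrite sumr_const /K -mulnA -mulr_natl PoszM natz.
pose g (f : {ffun I -> 'I_h}) : {ffun J -> 'I_(2 * K).+1} :=
  [ffun j => inord (absz (v f j + K%:Z)%R)].
have /injectivePn [f [f' nff' gff']] : ~~ injectiveb g.
  apply/injectiveP => g_inj; have := leq_card g g_inj.
  by rewrite !card_ffun !card_ord leqNgt lt_h.
exists (fun i => (f i)%:Z - (f' i)%:Z); split.
- have /existsP[i nfi] : [exists i, f i != f' i].
    apply: contraNT nff' => /existsPn eqf; apply/eqP/ffunP => i.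
    by apply/eqP; rewrite -[_ == _]negbK eqf.
  by exists i; rewrite subr_eq0 eqz_nat.
- move=> i; have := ltn_ord (f i); have := ltn_ord (f' i).
  by move: (nat_of_ord (f i)) (nat_of_ord (f' i)) => a b ltbh ltah; clear -ltbh ltah; lia.
move=> j; under eq_bigr do rewrite mulrBl.
rewrite sumrB; apply/eqP; rewrite subr_eq0; apply/eqP.
have := congr1 (fun u : {ffun _ -> _} => u j) gff'; rewrite !ffunE => /(congr1 val) /=.
have := v_bound f j; have := v_bound f' j; rewrite -/(v f j) -/(v f' j).
move: (v f j) (v f' j) => a b b1 b2.
by rewrite !inordK; clear -b1 b2; lia.
Qed.

(** * The operator z d/dz and first order equations *)

Section Theta.
Variable R : numFieldType.
Implicit Types p q : {poly R}.

Definition theta p := 'X * p^`().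

Lemma coef_theta p i : (theta p)`_i = p`_i *+ i.
Proof. by rewrite coefXM coef_deriv; case: i. Qed.

Lemma thetaD p q : theta (p + q) = theta p + theta q.
Proof. by rewrite /theta derivD mulrDr. Qed.

Lemma thetaM p q : theta (p * q) = theta p * q + p * theta q.
Proof. rewrite /theta derivM; ring. Qed.

Lemma thetaC c : theta c%:P = 0.
Proof. by rewrite /theta derivC mulr0. Qed.

Lemma theta0 : theta 0 = 0.
Proof. by rewrite -(polyC0 R) thetaC. Qed.

Lemma thetaXn p n : theta (p ^+ n.+1) = p ^+ n * theta p *+ n.+1.
Proof.
elim: n => [|n IHn]; first by rewrite expr1 mul1r.
rewrite exprS thetaM IHn exprS [RHS]mulrS; ring.
Qed.

Lemma thetaX : theta 'X = 'X.
Proof. by rewrite /theta derivX mulr1. Qed.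

Definition XsubC_exp (a : R) n : {poly R} := ('X - a%:P) ^+ n.

Lemma theta_XsubC_exp (a : R) n :
  theta (XsubC_exp a n.+1) = XsubC_exp a n * (n.+1%:R *: 'X).
Proof.
rewrite /XsubC_exp thetaXn -['X - _]/('X + - a%:P) -polyCN thetaD thetaC thetaX addr0.
by rewrite -mulrnAr -mul_polyC -mulr_natl polyC_natr.
Qed.

Lemma theta_sum (I : Type) (r : seq I) (P : pred I) (F : I -> {poly R}) :
  theta (\sum_(i <- r | P i) F i) = \sum_(i <- r | P i) theta (F i).
Proof. by rewrite /theta raddf_sum mulr_sumr. Qed.

Lemma size_theta p : (size (theta p) <= size p)%N.
Proof. by apply/leq_sizeP => j le_pj; rewrite coef_theta nth_default ?mul0rn. Qed.

(** The quotient is a constant [e] for reasons of degree. Then [i * q_i = e * q_i] for every [i],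
    which leaves room for only one nonzero coefficient. *)
Lemma theta_dvd q : q != 0 -> q %| theta q -> exists2 c, c != 0 & q = c *: 'X^((size q).-1).
Proof.
move=> q0 /dvdpP[d thq].
have sd : (size d <= 1)%N.
  have [->|d0] := eqVneq d 0; first by rewrite size_poly0.
  have := size_theta q; rewrite thq size_mul //.
  have : (0 < size q)%N by rewrite size_poly_gt0.
  have : (0 < size d)%N by rewrite size_poly_gt0.
  by move: (size d) (size q) => a b; lia.
have [e de] : exists e, d = e%:P by exists d`_0; apply: size1_polyC.
exists (lead_coef q); rewrite ?lead_coef_eq0 //.
have thE i : q`_i *+ i = e * q`_i by rewrite -coef_theta thq de coefCM.
have eE : e = (size q).-1%:R.
  have lc0 : lead_coef q != 0 by rewrite lead_coef_eq0.
  by apply: (mulIf lc0); rewrite mulr_natl; apply/esym/thE.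
apply/polyP => i; rewrite coefZ coefXn.
have [->|ni] := eqVneq i (size q).-1; first by rewrite mulr1.
rewrite mulr0; have /eqP := thE i; rewrite -mulr_natl eE -subr_eq0 -mulrBl mulf_eq0.
by rewrite subr_eq0 eqr_nat (negPf ni) => /eqP.
Qed.

(* The fraction [u = P / q] solves [theta u = k z u + m]: a pole of [u] would
   be a pole of higher order of [theta u] away from 0, and its polar part at 0
   could not cancel. Hence [u] is a polynomial, and degrees leave a constant. *)
Lemma rational_solution_const P q (k m : R) : q != 0 ->
  q * theta P - theta q * P = k *: ('X * (q * P)) + m *: (q * q) ->
  m = 0 /\ exists2 c, P = c *: q & (k != 0 -> c = 0).
Proof.
move=> q0 eqn.
pose g := gcdp P q.
have g0 : g != 0 by rewrite gcdp_eq0 negb_and q0 orbT.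
have [P1 PE] : exists P1, P = P1 * g by apply/dvdpP/dvdp_gcdl.
have [q1 qE] : exists q1, q = q1 * g by apply/dvdpP/dvdp_gcdr.
have q10 : q1 != 0 by apply: contraNneq q0 => q10; rewrite qE q10 mul0r.
have cop : coprimep P1 q1.
  have : (P != 0) || (q != 0) by rewrite q0 orbT.
  by move/coprimep_div_gcd; rewrite -/g {1}PE {1}qE !mulpK.
have eqn1 : q1 * theta P1 - theta q1 * P1 = k *: ('X * (q1 * P1)) + m *: (q1 * q1).
  apply: (mulIf (mulf_neq0 g0 g0)).
  transitivity (q * theta P - theta q * P).
    by rewrite qE PE !thetaM; ring.
  by rewrite eqn PE qE -!mul_polyC; ring.
have : q1 %| theta q1.
  rewrite -(Gauss_dvdpl _ (_ : coprimep q1 P1)) 1?coprimep_sym //.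
  have -> : theta q1 * P1 = q1 * (theta P1 - (k *: ('X * P1) + m *: q1)).
    have -> : theta q1 * P1 = q1 * theta P1 - (q1 * theta P1 - theta q1 * P1) by ring.
    by rewrite eqn1 -!mul_polyC; ring.
  exact: dvdp_mulr.
move=> /(theta_dvd q10)[c c0]; set s := (size q1).-1 => q1E.
have thq1 : theta q1 = s%:R *: q1.
  apply/polyP => i; rewrite coef_theta q1E !coefZ coefXn.
  by case: eqP => [->|]; rewrite ?mulr0 ?mul0rn ?mulr0 // !mulr1 mulr_natl.
have eqn2 : theta P1 - s%:R *: P1 = k *: ('X * P1) + m *: q1.
  apply: (mulfI q10); rewrite -[RHS]/(q1 * (k *: ('X * P1) + m *: q1)).
  transitivity (q1 * theta P1 - theta q1 * P1).
    by rewrite thq1 -!mul_polyC; ring.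
  by rewrite eqn1 -!mul_polyC; ring.
(* For [s > 0] the constant terms of [eqn2] make 0 a root of [P1]; it is also a root of
   [q1 = c X^s], against coprimality. *)
have s0 : s = 0%N.
  apply/eqP; case: (posnP s) => // s_gt0.
  have P10 : P1`_0 = 0.
    have := congr1 (fun p : {poly R} => p`_0) eqn2.
    rewrite coefB coefZ coef_theta mulr0n add0r coefD !coefZ coefXM mulr0 add0r.
    rewrite q1E coefZ coefXn (ltn_eqF s_gt0) !mulr0 => /eqP.
    by rewrite oppr_eq0 mulf_eq0 pnatr_eq0 (gtn_eqF s_gt0) => /eqP.
  have rP : root P1 0 by rewrite rootE horner_coef0 P10.
  have := coprimep_root cop rP.
  by rewrite horner_coef0 q1E coefZ coefXn (ltn_eqF s_gt0) mulr0 eqxx.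
have q1C : q1 = c%:P by rewrite q1E s0 expr0 alg_polyC.
rewrite s0 scale0r subr0 q1C in eqn2.
have m0 : m = 0.
  have := congr1 (fun p : {poly R} => p`_0) eqn2.
  rewrite coef_theta mulr0n coefD !coefZ coefXM mulr0 add0r coefC eqxx => /esym/eqP.
  by rewrite mulf_eq0 (negPf c0) orbF => /eqP.
split=> //; rewrite m0 scale0r addr0 in eqn2.
have [k0|k0] := eqVneq k 0.
  exists (P1`_0 / c) => //; rewrite PE qE q1C -mul_polyC mulrA -polyCM divfK //.
  congr (_ * _); apply/size1_polyC/leq_sizeP => -[//|i] _.
  have := congr1 (fun p : {poly R} => p`_i.+1) eqn2.
  rewrite k0 scale0r coef0 coef_theta => /eqP; rewrite -mulr_natl mulf_eq0 pnatr_eq0 /=.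
  by move/eqP.
exists 0 => //; rewrite scale0r PE.
suff -> : P1 = 0 by rewrite mul0r.
(* For a nonzero [P1], the degree of [k X P1] would exceed that of [theta P1]. *)
apply: contraTeq (size_theta P1) => P1n0.
by rewrite eqn2 size_scale // mulrC size_mulX // ltnn.
Qed.

End Theta.

(** * Minors *)

(** Induction on the rows, staying inside the domain: the signed minors [C] on the columns [f] form
    a nonzero row, so [C *m A] has a nonzero entry [j], and by Laplace expansion this entry is the
    minor on the columns [j] and [f]. *)
Lemma exists_minor_neq0 (R : idomainType) r M (A : 'M[R]_(r, M)) :
  (forall v : 'rV_r, v *m A = 0 -> v = 0) ->
  exists f : 'I_r -> 'I_M, \det (colsub f A) != 0.
Proof.
elim: r => [|r IHr] in A * => freeA.
  have f : 'I_0 -> 'I_M by case.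
  by exists f; rewrite det_mx00 oner_neq0.
have [|f det_f] := IHr (row' 0 A).
  move=> v vA; pose w := \row_(i < r.+1) (if unlift 0 i is Some i' then v 0 i' else 0).
  have : w = 0.
    apply: freeA; rewrite -[RHS]vA; apply/rowP => j; rewrite !mxE big_ord_recl.
    rewrite mxE unlift_none mul0r add0r; apply: eq_bigr => i _.
    by rewrite !mxE liftK.
  move=> /rowP w0; apply/rowP => i; have := w0 (lift 0 i).
  by rewrite !mxE liftK.
pose C := \row_(i < r.+1) ((-1) ^+ i * \det (row' i (colsub f A))).
have C0 : C != 0.
  apply: contraNneq det_f => /rowP/(_ 0); rewrite !mxE expr0 mul1r => /eqP.
  by congr (\det _ == 0); apply/matrixP => i j; rewrite !mxE.
have [j CAj] : exists j, (C *m A) 0 j != 0.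
  by apply/rV0Pn; apply: contra_neq C0 => /freeA.
exists (fun i => if unlift 0 i is Some i' then f i' else j).
rewrite (expand_det_col _ 0); apply: contraNneq CAj => sum0; rewrite mxE -[X in _ == X]sum0.
apply/eqP/eq_bigr => i _; rewrite !mxE unlift_none mulrC; congr (_ * _).
rewrite /cofactor addn0; congr (_ * \det _).
by apply/matrixP => k l; rewrite !mxE liftK.
Qed.

Lemma size_det_leq (R : comNzRingType) n S (A : 'M[{poly R}]_n) :
  (forall i j, size (A i j) <= S.+1)%N -> (size (\det A) <= (n * S).+1)%N.
Proof.
move=> sA; apply: leq_trans (size_sum _ _ _) _; apply/bigmax_leqP => s _.
rewrite size_Msign; apply: leq_trans (size_poly_prod_leq _ _) _.
rewrite leq_subLR card_ord addnS ltnS -mulnS -[X in (X * _)%N]card_ord -sum_nat_const.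
exact: leq_sum.
Qed.

(** * Zero estimates for linear differential systems *)

Lemma dvdpXnP (R : fieldType) T (p : {poly R}) :
  reflect (forall t, (t < T)%N -> p`_t = 0) ('X^T %| p).
Proof.
apply: (iffP idP) => [/dvdpP[q ->] t lt_tT|p0].
  by rewrite coefMXn lt_tT.
apply/dvdpP; exists (drop_poly T p).
rewrite -[LHS](poly_take_drop T) -[RHS]add0r; congr (_ + _).
apply/polyP => t; rewrite coef_take_poly coef0; case: ltnP => // lt_tT.
exact: p0.
Qed.

Section LinearSystem.
Variables (R : numFieldType) (M : nat) (k : 'I_M -> nat) (N : 'M[R]_M).
Implicit Types (u v w : 'rV[{poly R}]_M) (p q : {poly R}).

(** The action of [theta] on coefficient vectors: along a solution [y] of the system, [theta (sum_b
    w_b y_b) = sum_b (delta w)_b y_b]. *)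
Definition delta w : 'rV[{poly R}]_M :=
  \row_b (theta (w 0 b) + (k b)%:R *: ('X * w 0 b) + \sum_a w 0 a * (N a b)%:P).

Lemma deltaD u v : delta (u + v) = delta u + delta v.
Proof.
apply/rowP => b; rewrite !mxE thetaD -!mul_polyC.
under [in LHS]eq_bigr do rewrite mxE mulrDl.
rewrite big_split /=; ring.
Qed.

Lemma deltaZ p w : delta (p *: w) = theta p *: w + p *: delta w.
Proof.
apply/rowP => b; rewrite !mxE thetaM -!mul_polyC.
under eq_bigr do rewrite mxE -mulrA.
rewrite -mulr_sumr; ring.
Qed.

Lemma delta0 : delta 0 = 0.
Proof. by have := deltaZ 0 0; rewrite -(polyC0 R) thetaC polyC0 !scale0r addr0. Qed.

Lemma delta_sum (I : Type) (r : seq I) (P : pred I) (F : I -> 'rV[{poly R}]_M) :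
  delta (\sum_(i <- r | P i) F i) = \sum_(i <- r | P i) delta (F i).
Proof. exact: (big_morph delta deltaD delta0). Qed.

Section Solution.
Variable Y : 'I_M -> nat -> R.
Hypothesis Yrec : forall a t,
  Y a t *+ t = (k a)%:R * (if t is t'.+1 then Y a t' else 0) + \sum_b N a b * Y b t.

(* Power series enter only through their truncations: the order of a form at 0 is
   at least [T] when ['X^T] divides its truncated value. *)
Definition trunc_eval T w := \sum_b w 0 b * \poly_(t < T) Y b t.

Lemma trunc_evalZ T p w : trunc_eval T (p *: w) = p * trunc_eval T w.
Proof. by rewrite mulr_sumr; apply: eq_bigr => b _; rewrite mxE mulrA. Qed.

Lemma trunc_eval_sum T (I : Type) (r : seq I) (P : pred I) (F : I -> 'rV[{poly R}]_M) :
  trunc_eval T (\sum_(i <- r | P i) F i) = \sum_(i <- r | P i) trunc_eval T (F i).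
Proof.
rewrite exchange_big; apply: eq_bigr => b _.
by rewrite summxE mulr_suml.
Qed.

(** The truncated series solve the system modulo ['X^T]; the difference is a combination of the
    residues of its equations. *)
Lemma trunc_eval_delta T w :
  'X^T %| trunc_eval T (delta w) - theta (trunc_eval T w).
Proof.
pose Yp b := \poly_(t < T) Y b t.
have -> : trunc_eval T (delta w) - theta (trunc_eval T w) =
    \sum_a w 0 a * ((k a)%:R *: ('X * Yp a) + \sum_b (N a b)%:P * Yp b - theta (Yp a)).
  have ex : \sum_b (\sum_a w 0 a * (N a b)%:P) * Yp b =
            \sum_a w 0 a * \sum_b (N a b)%:P * Yp b.
    under eq_bigr do rewrite mulr_suml.
    rewrite exchange_big; apply: eq_bigr => a _.
    by rewrite mulr_sumr; apply: eq_bigr => b _; rewrite mulrA.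
  under [RHS]eq_bigr do rewrite addrAC mulrDr.
  rewrite [RHS]big_split /= -ex theta_sum -sumrB -big_split; apply: eq_bigr => b _ /=.
  by rewrite mxE thetaM -/(Yp b) -!mul_polyC; ring.
apply: (big_ind (fun p => 'X^T %| p)) => [|p q|a _]; rewrite ?dvdp0 //.
  exact: dvdp_add.
apply/dvdp_mull/dvdpXnP => t lt_tT.
have YpE b s : (s < T)%N -> (Yp b)`_s = Y b s by move=> lt_sT; rewrite coef_poly lt_sT.
rewrite coefB coefD coefZ coefXM coef_theta YpE // Yrec coef_sum.
apply/eqP; rewrite subr_eq0; apply/eqP; congr (_ + _).
  by case: t lt_tT => [|t] lt_tT; rewrite /= ?mulr0 // YpE // ltnW.
by apply: eq_bigr => b _; rewrite coefCM YpE.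
Qed.

Lemma dvd_trunc_eval_iter_delta T w i :
  'X^T %| trunc_eval T w -> 'X^T %| trunc_eval T (iter i delta w).
Proof.
move=> w0; elim: i => //= i IHi.
rewrite -(subrK (theta (trunc_eval T (iter i delta w))) (trunc_eval T _)).
rewrite dvdp_add ?trunc_eval_delta //.
apply/dvdpXnP => t lt_tT; rewrite coef_theta.
by rewrite (dvdpXnP _ _ IHi) ?mul0rn.
Qed.

Section Degree.
Variables (rk : 'I_M -> nat).
Hypothesis rk_inj : injective rk.
Hypothesis N_lower : forall a b, N a b != 0 -> (rk b < rk a)%N.
(** Such a constant form satisfies [delta c = j z c], so its value is a multiple of [exp(jz)]; the
    multiple is required to be nonzero. *)
Hypothesis leading : forall (c : 'rV[R]_M) j, c != 0 -> c *m N = 0 ->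
  (forall b, c 0 b != 0 -> k b = j) -> \sum_b c 0 b * Y b 0%N != 0.

(* A nonzero [delta]-stable space contains a vector [q *: c] with [c] constant:
   if [u] has minimal leading index [p], then [u 0 p *: delta u] is a multiple
   of [u], so the ratios [u 0 b / u 0 p] solve first order equations. *)
Lemma stable_has_constant (W : 'rV[{poly R}]_M -> Prop) u0 :
  (forall u v, W u -> W v -> W (u + v)) -> (forall p u, W u -> W (p *: u)) ->
  (forall u, W u -> W (delta u)) -> u0 != 0 -> W u0 ->
  exists (c : 'rV[R]_M) q, [/\ q != 0, W (q *: map_mx polyC c) &
    \sum_b c 0 b * Y b 0%N != 0].
Proof.
move=> WD WZ Wdelta u00 Wu0.
pose lead l := `[< exists u, [/\ u != 0, W u & forall b, (l < rk b)%N -> u 0 b = 0] >].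
have ex_lead : exists l, lead l.
  exists (\max_b rk b); apply/asboolP; exists u0; split=> // b.
  by rewrite ltnNge leq_bigmax.
have [l /asboolP[u [u_neq0 Wu u_lead]] l_min] := ex_minnP ex_lead.
have [p rk_p up0] : exists2 p, rk p = l & u 0 p != 0.
  apply: contrapT => no_p; have [b ub0] := rV0Pn _ u_neq0.
  have lt_l b' : u 0 b' != 0 -> (rk b' < l)%N.
    move=> ub'; rewrite ltn_neqAle; apply/andP; split.
      by apply/eqP => rkb'; apply: no_p; exists b'.
    by rewrite leqNgt; apply: contra_neqN ub' => /u_lead.
  have l_gt0 := leq_ltn_trans (leq0n _) (lt_l b ub0).
  have : lead l.-1.
    apply/asboolP; exists u; split=> // b' lt_lb'; apply/eqP; apply: contraT => /lt_l ltb'.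
    by move: lt_lb'; rewrite ltnNge -ltnS prednK // ltb'.
  by move=> /l_min; rewrite -{1}(prednK l_gt0) ltnn.
set q := u 0 p in up0.
have vanish v : W v -> (forall b, (l <= rk b)%N -> v 0 b = 0) -> v = 0.
  move=> Wv v0; apply/eqP; apply: contraT => v_neq0.
  have [l0|l_gt0] := posnP l.
    by case/rV0Pn: v_neq0 => b; rewrite v0 ?eqxx // l0.
  have : lead l.-1.
    apply/asboolP; exists v; split=> // b lt_lb; apply: v0.
    by rewrite -(prednK l_gt0).
  by move=> /l_min; rewrite -{1}(prednK l_gt0) ltnn.
have prop_u : q *: delta u = (theta q + (k p)%:R *: ('X * q)) *: u.
  apply/eqP; rewrite -subr_eq0 -scaleNr; apply/eqP/vanish.
    by apply: (WD); apply: (WZ) => //; apply: Wdelta.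
  move=> b le_lb; rewrite !mxE.
  have sum0 : \sum_a u 0 a * (N a b)%:P = 0.
    apply: big1 => a _; have [->|Nab] := eqVneq (N a b) 0; first by rewrite mulr0.
    by rewrite u_lead ?mul0r // (leq_ltn_trans le_lb) // N_lower.
  rewrite sum0 addr0; have [lt_lb|] := ltnP l (rk b).
    by rewrite u_lead // theta0 -!mul_polyC; ring.
  rewrite leq_eqVlt ltnNge le_lb orbF -rk_p => /eqP /rk_inj ->.
  by rewrite -/q -!mul_polyC; ring.
(* By [prop_u] the ratio [f = u 0 b / q] solves [theta f = (k p - k b) z f - m] as soon as the
   coupling term is the constant [m] times [q]. *)
have ode b m : \sum_a u 0 a * (N a b)%:P = m *: q ->
    m = 0 /\ exists2 c, u 0 b = c *: q & ((k p)%:R - (k b)%:R != 0 :> R -> c = 0).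
  move=> sumE; have [m0 cP] : - m = 0 /\ exists2 c, u 0 b = c *: q &
      ((k p)%:R - (k b)%:R != 0 :> R -> c = 0).
    apply: rational_solution_const => //.
    have /rowP/(_ b) := prop_u; rewrite !mxE sumE -!mul_polyC polyCN polyCB => E.
    have -> : q * theta (u 0 b) = (theta q + (k p)%:R%:P * ('X * q)) * u 0 b
                                  - (k b)%:R%:P * ('X * (q * u 0 b)) - m%:P * (q * q).
      by rewrite -E; ring.
    ring.
  by split=> //; apply/eqP; rewrite -oppr_eq0 m0.
(* Descending induction on the rank: the entries coupled into [b] have larger rank, hence are
   already constant multiples of [q]. *)
have const_u j b : (l < rk b + j)%N -> exists2 c, u 0 b = c *: q & c != 0 -> k b = k p.
  elim: j b => [|j IHj] b lt_l.
    by exists 0; rewrite ?eqxx // u_lead ?scale0r // -[rk b]addn0.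
  have /choice[c cP] a : exists c, (rk b < rk a)%N -> u 0 a = c *: q.
    have [lt_ba|] := boolP (rk b < rk a)%N; last by exists 0.
    have [|c ->] := IHj a; last by exists c.
    by apply: leq_trans lt_l _; rewrite addnS -addSn leq_add2r.
  have [|m0 [d uE dP]] := ode b (\sum_a c a * N a b).
    rewrite scaler_suml; apply: eq_bigr => a _.
    have [->|/N_lower lt_ba] := eqVneq (N a b) 0; first by rewrite !mulr0 scale0r.
    by rewrite cP // -!mul_polyC polyCM mulrAC.
  exists d => // d0; apply/eqP; apply: contraNT d0 => kbp.
  by apply/eqP/dP; rewrite subr_eq0 eqr_nat eq_sym.
have /choice[c cP] b : exists c, u 0 b = c *: q /\ (c != 0 -> k b = k p).
  have [|c] := const_u l.+1 b; first by rewrite addnS ltnS leq_addl.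
  by exists c.
exists (\row_b c b), q; have uE : q *: map_mx polyC (\row_b c b) = u.
  by apply/rowP => b; rewrite !mxE (cP b).1 -mul_polyC mulrC.
split=> //; first by rewrite uE.
apply: (leading (j := k p)).
- apply: contraNneq u_neq0 => c0; rewrite -uE c0.
  by apply/eqP/rowP => b; rewrite !mxE mulr0.
- apply/rowP => b; rewrite !mxE.
  have [|E _] := ode b (\sum_a c a * N a b).
    rewrite scaler_suml; apply: eq_bigr => a _.
    by rewrite (cP a).1 -!mul_polyC polyCM mulrAC.
  by rewrite -[RHS]E; apply: eq_bigr => a _; rewrite mxE.
by move=> b; rewrite mxE => /(cP b).2.
Qed.

(** * Successive derivatives of a form with a high order zero *)

Section Iterates.
Variables (L : 'rV[{poly R}]_M) (S T : nat).
Hypothesis L_neq0 : L != 0.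
Hypothesis size_L : forall b, (size (L 0%R b) <= S.+1)%N.
Hypothesis L_small : 'X^T %| trunc_eval T L.

Local Notation D i := (iter i delta L).

Definition iterates m : 'M[{poly R}]_(m, M) := \matrix_(i < m) D i.

Lemma mul_iterates m (x : 'rV_m) : x *m iterates m = \sum_(i < m) x 0 i *: D i.
Proof. by rewrite mulmx_sum_row; apply: eq_bigr => i _; rewrite rowK. Qed.

Lemma size_iterates i b : (size (D i 0%R b) <= (S + i).+1)%N.
Proof.
elim: i b => [|i IHi] b /=; first by rewrite addn0.
rewrite mxE addnS.
apply: leq_trans (size_polyD _ _) _; rewrite geq_max; apply/andP; split.
  apply: leq_trans (size_polyD _ _) _; rewrite geq_max; apply/andP; split.
    by apply: leq_trans (size_theta _) _; apply: leq_trans (IHi b) _.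
  apply: leq_trans (size_scale_leq _ _) _.
  have [->|D0] := eqVneq (D i 0 b) 0; first by rewrite mulr0 size_poly0.
  by rewrite mulrC size_mulX // ltnS.
apply: leq_trans (size_sum _ _ _) _; apply/bigmax_leqP => a _.
rewrite mulrC mul_polyC; apply: leq_trans (size_scale_leq _ _) _.
by apply: leq_trans (IHi a) _.
Qed.

Lemma dvd_trunc_eval_mul_iterates m (x : 'rV_m) :
  'X^T %| trunc_eval T (x *m iterates m).
Proof.
rewrite mul_iterates trunc_eval_sum; apply: (big_ind (fun p => 'X^T %| p)) => [|p q|i _].
- exact: dvdp0.
- exact: dvdp_add.
by rewrite trunc_evalZ dvdp_mull // dvd_trunc_eval_iter_delta.
Qed.

(** The truncated value of [c] has a nonzero constant term, so it is coprime to ['X^T]. *)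
Lemma dvd_of_trunc_eval d (c : 'rV[R]_M) : \sum_b c 0 b * Y b 0%N != 0 ->
  'X^T %| trunc_eval T (d *: map_mx polyC c) -> 'X^T %| d.
Proof.
move=> c0; rewrite trunc_evalZ; case: (posnP T) => [->|T0].
  by rewrite !expr0 !dvd1p.
rewrite Gauss_dvdpl //; apply: coprimep_expl; rewrite coprimep_sym.
rewrite -[X in coprimep _ X]subr0 -(polyC0 R) coprimep_XsubC rootE horner_coef0.
rewrite coef_sum; apply: contraNneq c0 => /eqP c0; apply/eqP; rewrite -[RHS](eqP c0).
by apply: eq_bigr => b _; rewrite mxE coefCM coef_poly T0.
Qed.

Lemma size_of_dvdXn (d : {poly R}) : d != 0 -> 'X^T %| d -> (T < size d)%N.
Proof. by move=> d0 /dvdp_leq; rewrite size_polyXn; apply. Qed.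

(** Dependence of [D r] on the earlier derivatives over the rational functions, with the
    denominators cleared into [q]. *)
Definition dependent r := exists (q : {poly R}) (x : 'rV_r), q != 0 /\ q *: D r = x *m iterates r.

Lemma dependent_of_kernel r (v : 'rV_r) :
  v != 0 -> v *m iterates r = 0 -> exists2 i, (i < r)%N & dependent i.
Proof.
elim: r v => [|r IHr] v v0 vD; first by case/rV0Pn: v0 => -[].
pose w := \row_(i < r) v 0 (widen_ord (leqnSn r) i).
have E : w *m iterates r + v 0 ord_max *: D r = 0.
  rewrite -[RHS]vD !mul_iterates big_ord_recr; congr (_ + _).
  by apply: eq_bigr => i _; rewrite mxE.
have [vmax0|vmax_neq0] := eqVneq (v 0 ord_max) 0; last first.
  exists r => //; exists (v 0 ord_max), (- w); split=> //.
  by apply/eqP; rewrite mulNmx -addr_eq0 addrC E.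
have [||i lt_ir dep_i] := IHr w; last by exists i => //; apply: ltnW.
  apply: contraNneq v0 => /rowP w0; apply/eqP/rowP => i; rewrite mxE.
  case: (unliftP ord_max i) => [j ->|->] //.
  have := w0 j; rewrite !mxE => w0j; rewrite -[RHS]w0j; congr (v 0 _); apply/val_inj => /=.
  by rewrite /bump leqNgt ltn_ord.
by move: E; rewrite vmax0 scale0r addr0.
Qed.

(** Otherwise the span of the derivatives before the first dependence is stable under [delta], hence
    contains a constant form [c]. A minor times [c] is then a polynomial combination of derivatives,
    so ['X^T] divides that minor, whose degree is too small. *)
Lemma det_iterates_neq0 : (M.-1 * (S + M) < T)%N -> \det (iterates M) != 0.
Proof.
move=> lt_T; apply/negP => /det0P[v v0 vD].
have [i lt_iM dep_i] := dependent_of_kernel v0 vD.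
have ex_dep : exists i, `[< dependent i >] by exists i; apply/asboolP.
have [r /asboolP[q0 [x0 [q0_neq0 depE]]] r_min] := ex_minnP ex_dep.
have lt_rM : (r < M)%N by apply: leq_ltn_trans lt_iM; apply/r_min/asboolP.
have free_r (x : 'rV_r) : x *m iterates r = 0 -> x = 0.
  move=> xD; apply/eqP; apply: contraT => /dependent_of_kernel/(_ xD)[j lt_jr dep_j].
  by have := r_min j (asboolT dep_j); rewrite leqNgt lt_jr.
(* The polynomial vectors in the span of the first [r] derivatives over the rational functions. *)
pose W u := exists q (x : 'rV_r), q != 0 /\ q *: u = x *m iterates r.
have WD u w : W u -> W w -> W (u + w).
  move=> [p [x [p0 px]]] [q [y [q0' qy]]]; exists (p * q), (q *: x + p *: y).
  rewrite mulf_neq0 // mulmxDl -!scalemxAl -px -qy !scalerA scalerDr; split=> //.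
  by rewrite [q * p]mulrC.
have WZ p u : W u -> W (p *: u).
  move=> [q [y [q0' qy]]]; exists q, (p *: y); split=> //.
  by rewrite -scalemxAl -qy !scalerA mulrC.
have Wsat p u : p != 0 -> W (p *: u) -> W u.
  move=> p0 [q [y [q0' qy]]]; exists (q * p), y; rewrite mulf_neq0 //; split=> //.
  by rewrite -scalerA.
have WD_le j : (j <= r)%N -> W (D j).
  rewrite leq_eqVlt => /predU1P[->|lt_jr]; first by exists q0, x0.
  exists 1, (delta_mx 0 (Ordinal lt_jr)); rewrite oner_neq0 scale1r; split=> //.
  by rewrite -rowE rowK.
have W0 : W 0 by exists 1, 0; rewrite oner_neq0 scaler0 mul0mx.
have Wdelta u : W u -> W (delta u).
  move=> Wu; have [q [x [q0' qx]]] := Wu; apply: (Wsat q) => //.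
  have -> : q *: delta u = delta (q *: u) + (- theta q) *: u.
    by rewrite deltaZ scaleNr addrAC subrr add0r.
  apply: (WD); last exact: (WZ).
  rewrite qx mul_iterates delta_sum; apply: (big_ind W) => [//||j _]; first exact: (WD).
  rewrite deltaZ; apply: (WD); apply: (WZ); first by apply/WD_le/ltnW.
  by have := WD_le j.+1; apply.
have [c [q [q0' Wqc c0]]] := stable_has_constant WD WZ Wdelta L_neq0 (WD_le 0%N (leq0n _)).
have WQ : W (map_mx polyC c) := Wsat _ _ q0' Wqc.
have {WQ} [Q [y [Q0 Qy]]] := WQ.
have [f det_f] := exists_minor_neq0 free_r.
(* Cramer's rule replaces the uncontrolled denominator [Q] by [\det G], whose degree is bounded. *)
set G := colsub f (iterates r) in det_f.
set cf := colsub f (map_mx polyC c).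
have QcG : Q *: (cf *m \adj G) = \det G *: y.
  rewrite scalemxAl -[Q *: cf]/(Q *: colsub f (map_mx polyC c)).
  have -> : Q *: colsub f (map_mx polyC c) = y *m G.
    by rewrite /G mulmx_colsub -Qy; apply/rowP => j; rewrite !mxE.
  by rewrite -mulmxA mul_mx_adj mul_mx_scalar.
have detc : \det G *: map_mx polyC c = (cf *m \adj G) *m iterates r.
  apply: (scalemx_inj Q0); rewrite scalemxAl QcG -scalemxAl -Qy.
  by rewrite !scalerA mulrC.
have : (T < (r * (S + r)).+1)%N.
  apply: leq_trans (size_of_dvdXn det_f _) _.
    by apply: (dvd_of_trunc_eval c0); rewrite detc; apply: dvd_trunc_eval_mul_iterates.
  apply: size_det_leq => i' j; rewrite !mxE.
  apply: leq_trans (size_iterates _ _) _.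
  by rewrite ltnS leq_add2l ltnW.
rewrite ltnS leqNgt; apply/negP; rewrite negbK.
apply: leq_ltn_trans lt_T; apply: leq_mul; first by case: (M) lt_rM.
by rewrite leq_add2l ltnW.
Qed.

Definition at1 m (u : 'M[{poly R}]_(m, M)) : 'M[R]_(m, M) := map_mx (horner_eval 1) u.

(** By the product rule [delta (x D_i) = theta x D_i + x D_(i+1)], so each application involves one
    more derivative. *)
Lemma iter_delta_mul_iterates m (x : 'rV_m) s :
  exists y : 'rV_(m + s), iter s delta (x *m iterates m) = y *m iterates (m + s).
Proof.
elim: s => [|s [y yE]]; first by rewrite addn0; exists x.
rewrite addnS iterS yE.
exists (\row_i ((if unlift ord_max i is Some j then theta (y 0 j) else 0) +
                (if unlift 0 i is Some j then y 0 j else 0))).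
rewrite !mul_iterates delta_sum; under [RHS]eq_bigr do rewrite mxE scalerDl.
under [LHS]eq_bigr do rewrite deltaZ.
rewrite !big_split /=; congr (_ + _).
  rewrite big_ord_recr /= unlift_none scale0r addr0; apply: eq_bigr => i _.
  have -> : widen_ord (leqnSn (m + s)) i = lift ord_max i.
    by apply/val_inj; rewrite /= /bump leqNgt ltn_ord.
  by rewrite liftK.
rewrite big_ord_recl unlift_none scale0r add0r; apply: eq_bigr => i _.
by rewrite liftK.
Qed.

(** A term survives at 1 only if every [delta] differentiates a factor [X - 1], and [theta] of that
    factor is [X], equal to 1 there. *)
Lemma at1_iter_delta s v :
  at1 (iter s delta (XsubC_exp 1 s *: v)) = s`!%:R *: at1 v.
Proof.
elim: s v => [|s IHs] v; first by rewrite /XsubC_exp expr0 !scale1r.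
rewrite iterSr deltaZ theta_XsubC_exp.
have -> : XsubC_exp 1 s.+1 = XsubC_exp 1 s * ('X - 1%:P) :> {poly R} by rewrite /XsubC_exp exprSr.
rewrite -!scalerA -scalerDr IHs factS natrM mulrC -scalerA; congr (_ *: _).
apply/matrixP => i b; rewrite !mxE /horner_eval !hornerE /=.
by rewrite subrr mul0r addr0.
Qed.

(* The determinant has degree at most [M * (S + M)] and is divisible by ['X^T],
   which bounds its order of vanishing at 1, hence the number of extra derivatives. *)
Lemma row_full_at1_iterates b0 : Y b0 0%N != 0 -> \det (iterates M) != 0 ->
  row_full (at1 (iterates (M + (M * (S + M) - T)))).
Proof.
move=> Yb0; set d := \det _ => d0.
have adjE (c : 'rV[R]_M) : d *: map_mx polyC c = (map_mx polyC c *m \adj (iterates M)) *m iterates M.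
  by rewrite -mulmxA mul_adj_mx mul_mx_scalar.
have dvd_d : 'X^T %| d.
  apply: (@dvd_of_trunc_eval d (delta_mx 0 b0)).
    rewrite (bigD1 b0) //= big1 ?addr0 => [|b nb]; first by rewrite mxE !eqxx mul1r.
    by rewrite mxE (negPf nb) andbF mul0r.
  by rewrite adjE dvd_trunc_eval_mul_iterates.
have [s [g]] := multiplicity_XsubC d 1; rewrite d0 /= => g1 dE.
have le_s : (s <= M * (S + M) - T)%N.
  have cop : coprimep 'X^T (('X - 1%:P) ^+ s : {poly R}).
    apply/coprimep_expl/coprimep_expr.
    by rewrite coprimep_XsubC rootE hornerX oner_eq0.
  have g0 : g != 0 by apply: contraNneq g1 => ->; rewrite root0.
  have dvd_g : 'X^T %| g by move: dvd_d; rewrite dE Gauss_dvdpl.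
  have := size_of_dvdXn g0 dvd_g.
  have : (size d <= (M * (S + M)).+1)%N.
    apply: size_det_leq => i j; rewrite mxE; apply: leq_trans (size_iterates _ _) _.
    by rewrite ltnS leq_add2l ltnW.
  rewrite dE size_Mmonic ?monic_exp ?monicXsubC // size_exp_XsubC.
  by move: (size g) (M * (S + M))%N; clear; lia.
rewrite -sub1mx; apply/row_subP => b.
(* [d] times a unit vector is a combination of derivatives of [L]; applying [delta] [s] times and
   evaluating at 1 leaves [s! g(1)] times that vector. *)
pose c := delta_mx 0 b : 'rV[R]_M.
have [y yE] := iter_delta_mul_iterates (map_mx polyC c *m \adj (iterates M)) s.
have /(congr1 (@at1 1)) := yE.
rewrite -adjE dE mulrC -scalerA at1_iter_delta.
rewrite [RHS]map_mxM => eq1.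
have {eq1} c_sub : (c <= at1 (iterates (M + s)))%MS.
  have -> : c = (s`!%:R * g.[1])^-1 *: (s`!%:R *: at1 (g *: map_mx polyC c)).
    apply/rowP => j; rewrite !mxE /horner_eval hornerM hornerC [X in _ = _ * X]mulrA mulKf //.
    by rewrite mulf_neq0 // pnatr_eq0 -lt0n fact_gt0.
  by rewrite eq1 scalemxAl submxMl.
have -> : row b 1%:M = c by rewrite rowE mulmx1.
apply: submx_trans c_sub _; apply/row_subP => i.
have le_i : (i < M + (M * (S + M) - T))%N.
  by apply: leq_trans (ltn_ord i) _; rewrite leq_add2l.
have -> : row i (at1 (iterates (M + s))) = row (Ordinal le_i) (at1 (iterates (M + (M * (S + M) - T)))).
  by apply/rowP => j; rewrite !mxE.
exact: row_sub.
Qed.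

End Iterates.

End Degree.
End Solution.
End LinearSystem.

(** * Values at 1 and size estimates *)

Local Open Scope classical_set_scope.
Local Open Scope ring_scope.

Section Convergence.
Variable R : realType.

Lemma cvg_sum_finite (I : Type) (r : seq I) (F : I -> nat -> R) (f : I -> R) :
  (forall i, F i K @[K --> \oo] --> f i) ->
  \sum_(i <- r) F i K @[K --> \oo] --> \sum_(i <- r) f i.
Proof.
move=> Ff; elim: r => [|i r IHr].
  under eq_cvg do rewrite big_nil; rewrite big_nil; exact: cvg_cst.
under eq_cvg do rewrite big_cons; rewrite big_cons; exact: cvgD.
Qed.

(** Induction on [p]: a factor [X] shifts the partial sums of the Cauchy product by one index, and a
    constant scales the series. *)
Lemma cvg_conv_poly (p : {poly R}) (Z : nat -> R) z :
  \sum_(t < K) Z t @[K --> \oo] --> z ->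
  \sum_(t < K) \sum_(l < t.+1) p`_l * Z (t - l)%N @[K --> \oo] --> p.[1] * z.
Proof.
move=> Zz; elim/poly_ind: p => [|p c IHp].
  rewrite horner0 mul0r (_ : (fun K : nat => _) = cst 0); first exact: cvg_cst.
  apply/funext => K; apply: big1 => t _; apply: big1 => l _.
  by rewrite coef0 mul0r.
pose S K := \sum_(t < K) \sum_(l < t.+1) p`_l * Z (t - l)%N.
have E K : \sum_(t < K.+1) \sum_(l < t.+1) (p * 'X + c%:P)`_l * Z (t - l)%N =
     c * (\sum_(t < K.+1) Z t) + S K.
  under eq_bigr do rewrite big_ord_recl coefD coefMX coefC /= add0r subn0.
  rewrite big_split -mulr_sumr; congr (_ + _).
  rewrite big_ord_recl big_ord0 /= add0r; apply: eq_bigr => t _.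
  apply: eq_bigr => l _; rewrite coefD coefMX coefC /= addr0 /bump /= subSS.
  by [].
rewrite -cvg_shiftS (_ : [sequence _]_n = fun K => c * (\sum_(t < K.+1) Z t) + S K); last first.
  by apply/funext => K; exact: E.
rewrite !hornerE mulrDl addrC; apply: cvgD IHp.
apply: cvgMl_tmp; by rewrite (cvg_shiftS (fun K => \sum_(t < K) Z t)).
Qed.

End Convergence.

Section Estimates.
Variables (R : realType) (M : nat) (k : 'I_M -> nat) (N : 'M[R]_M).
Variables (Y : 'I_M -> nat -> R).
Implicit Types (w : 'rV[{poly R}]_M).
Hypothesis Yrec : forall a t,
  Y a t *+ t = (k a)%:R * (if t is t'.+1 then Y a t' else 0) + \sum_b N a b * Y b t.

Definition series_coef w t := \sum_b \sum_(l < t.+1) (w 0 b)`_l * Y b (t - l)%N.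

Lemma coef_trunc_eval T w t : (t < T)%N -> (trunc_eval Y T w)`_t = series_coef w t.
Proof.
move=> lt_tT; rewrite coef_sum; apply: eq_bigr => b _; rewrite coefM.
apply: eq_bigr => l _; rewrite coef_poly (leq_ltn_trans _ lt_tT) //.
exact: leq_subr.
Qed.

Lemma series_coef_delta w t : series_coef (delta k N w) t = series_coef w t *+ t.
Proof.
have /dvdpXnP/(_ t (ltnSn t)) := trunc_eval_delta Yrec t.+1 w.
by rewrite coefB coef_theta !coef_trunc_eval // => /eqP; rewrite subr_eq0 => /eqP.
Qed.

Lemma series_coef_iter w i t :
  series_coef (iter i (delta k N) w) t = series_coef w t * t%:R ^+ i.
Proof.
elim: i => [|i IHi]; first by rewrite expr0 mulr1.
by rewrite iterS series_coef_delta IHi exprSr mulrA mulr_natr.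
Qed.

Lemma cvg_series_coef w y : (forall b, \sum_(t < K) Y b t @[K --> \oo] --> y b) ->
  \sum_(t < K) series_coef w t @[K --> \oo] --> \sum_b (w 0 b).[1] * y b.
Proof.
move=> Yy; under eq_cvg do rewrite exchange_big.
apply: cvg_sum_finite => b; exact: cvg_conv_poly.
Qed.

(** [theta] multiplies the coefficient of [X^l] by [l <= S]; the other two terms of [delta] cost at
    most [K0 * H]. *)
Lemma coef_delta_le w (S K0 : nat) (H : R) :
  (forall b, (k b)%:R + \sum_a `|N a b| <= K0%:R) ->
  (forall b, (size (w 0%R b) <= S.+1)%N) -> (forall b l, `|(w 0 b)`_l| <= H) ->
  forall b l, `|(delta k N w 0 b)`_l| <= (S + K0)%:R * H.
Proof.
move=> K0P sw wH b l; rewrite mxE !coefD coefZ coefXM coef_theta coef_sum.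
have H0 : 0 <= H by apply: le_trans (wH b 0%N).
have b1 : `|(w 0 b)`_l *+ l| <= S%:R * H.
  have [lt_Sl|le_lS] := ltnP S l.
    by rewrite nth_default ?mul0rn ?normr0 ?mulr_ge0 // (leq_trans (sw b)).
  by rewrite normrMn -[leLHS]mulr_natl; apply: ler_pM; rewrite ?ler_nat.
have b2 : `|(k b)%:R * (if l == 0%N then 0 else (w 0 b)`_l.-1)| <= (k b)%:R * H.
  rewrite normrM ger0_norm // ler_wpM2l //; case: ifP => _ //.
  by rewrite normr0.
have b3 : `|\sum_a ((w 0 a) * (N a b)%:P)`_l| <= (\sum_a `|N a b|) * H.
  apply: le_trans (ler_norm_sum _ _ _) _; rewrite mulr_suml; apply: ler_sum => a _.
  by rewrite coefMC normrM mulrC ler_wpM2l.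
apply: le_trans (ler_normD _ _) _; rewrite natrD mulrDl.
apply: le_trans (lerD (ler_normD _ _) (lexx _)) _.
rewrite -addrA; apply: lerD => //; apply: le_trans (lerD b2 b3) _.
by rewrite -mulrDl ler_wpM2r.
Qed.

Lemma coef_iter_delta_le w (S K0 i m : nat) (H : R) :
  (forall b, (k b)%:R + \sum_a `|N a b| <= K0%:R) ->
  (forall b, (size (w 0%R b) <= S.+1)%N) -> (forall b l, `|(w 0 b)`_l| <= H) ->
  (i <= m)%N ->
  forall b l, `|(iter i (delta k N) w 0 b)`_l| <= (S + m + K0)%:R ^+ i * H.
Proof.
move=> K0P sw wH; elim: i => [|i IHi] le_im b l; first by rewrite expr0 mul1r.
have H0 : 0 <= H by apply: le_trans (wH b 0%N).
rewrite iterS; apply: le_trans (coef_delta_le K0P (S := (S + i)%N) _ (IHi (ltnW le_im)) _ _) _.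
  by move=> b'; apply: size_iterates.
rewrite exprS -mulrA ler_wpM2r ?mulr_ge0 ?exprn_ge0 //.
by rewrite ler_nat leq_add2r leq_add2l ltnW.
Qed.

Lemma norm_at1_le (p : {poly R}) S (H : R) :
  (size p <= S)%N -> (forall l, `|p`_l| <= H) -> `|p.[1]| <= S%:R * H.
Proof.
move=> sp pH; rewrite (horner_coef_wide _ sp).
apply: le_trans (ler_norm_sum _ _ _) _.
apply: (@le_trans _ _ (\sum_(l < S) H)).
  by apply: ler_sum => l _; rewrite expr1n mulr1.
by rewrite sumr_const card_ord mulr_natl.
Qed.

(** Majorization by [H exp(z) exp(Dz) = H exp((D+1)z)]. *)
Lemma series_coef_le w (D t : nat) (H : R) :
  (forall b s, `|Y b s| <= D%:R ^+ s / s`!%:R) ->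
  (forall b l, `|(w 0 b)`_l| <= H / l`!%:R) ->
  `|series_coef w t| <= M%:R * (H * (D.+1)%:R ^+ t / t`!%:R).
Proof.
move=> YD wH; have f0 v : v`!%:R != 0 :> R by rewrite pnatr_eq0 -lt0n fact_gt0.
apply: le_trans (ler_norm_sum _ _ _) _.
rewrite mulr_natl -[M in _ *+ M]card_ord -sumr_const; apply: ler_sum => b _.
apply: le_trans (ler_norm_sum _ _ _) _.
apply: (@le_trans _ _ (\sum_(l < t.+1) H / l`!%:R * (D%:R ^+ (t - l) / (t - l)`!%:R))).
  by apply: ler_sum => l _; rewrite normrM; apply: ler_pM.
rewrite -(addn1 D) natrD exprDn mulr_sumr mulr_suml.
rewrite le_eqVlt; apply/orP; left; apply/eqP; apply: eq_bigr => l _.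
have le_lt : (l <= t)%N by rewrite -ltnS.
rewrite expr1n mulr1 -(bin_fact le_lt) !natrM -mulr_natr.
have C0 : 'C(t, l)%:R != 0 :> R by rewrite pnatr_eq0 -lt0n bin_gt0.
by field; rewrite C0 !f0.
Qed.

End Estimates.

Section Tail.
Variable R : realType.

(** From [u! T! <= (T + u)!] and [(4G)^u <= u! 2^(u + 4G)], the terms are at most
    [G^T / T! * 2^(4G)] times those of a geometric series of ratio 1/2. *)
Lemma exp_tail_le (G T K : nat) :
  \sum_(u < K) G%:R ^+ (T + u) / (T + u)`!%:R <=
  G%:R ^+ T / T`!%:R * (2 ^ (4 * G).+1)%:R :> R.
Proof.
have f0 v : 0 < v`!%:R :> R by rewrite ltr0n fact_gt0.
have term u : G%:R ^+ (T + u) / (T + u)`!%:R <=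
    G%:R ^+ T / T`!%:R * ((2 ^ (4 * G))%:R * 2%:R^-1 ^+ u) :> R.
  have le1 : (G ^ u * 2 ^ u <= u`! * 2 ^ (4 * G))%N.
    rewrite -(@leq_pmul2r (2 ^ u)) ?expn_gt0 //.
    have -> : (G ^ u * 2 ^ u * 2 ^ u = (4 * G) ^ u)%N by rewrite -mulnA -!expnMn mulnC.
    have -> : (u`! * 2 ^ (4 * G) * 2 ^ u = u`! * 2 ^ (u + 4 * G))%N.
      by rewrite -mulnA -expnD [(u + _)%N]addnC.
    exact: expn_le_fact.
  have le2 : (u`! * T`! <= (T + u)`!)%N.
    have := @bin_fact (T + u) T (leq_addr _ _); rewrite addKn => <-.
    by rewrite [(u`! * _)%N]mulnC leq_pmull // bin_gt0 leq_addr.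
  have le : (G ^ (T + u) * (T`! * 2 ^ u) <= G ^ T * 2 ^ (4 * G) * (T + u)`!)%N.
    rewrite expnD; apply: (@leq_trans (G ^ T * (u`! * 2 ^ (4 * G) * T`!))).
      have -> : (G ^ T * G ^ u * (T`! * 2 ^ u) = G ^ T * (G ^ u * 2 ^ u * T`!))%N by lia.
      by apply: leq_mul => //; apply: leq_mul.
    have -> : (G ^ T * (u`! * 2 ^ (4 * G) * T`!) = G ^ T * 2 ^ (4 * G) * (u`! * T`!))%N by lia.
    by rewrite leq_mul.
  have -> : G%:R ^+ T / T`!%:R * ((2 ^ (4 * G))%:R * 2%:R^-1 ^+ u) =
     (G%:R ^+ T * (2 ^ (4 * G))%:R) / (T`!%:R * 2%:R ^+ u) :> R.
    by rewrite exprVn invfM; ring.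
  rewrite ler_pdivrMr // mulrAC ler_pdivlMr; last by rewrite mulr_gt0 ?exprn_gt0.
  by rewrite -!natrX -!natrM ler_nat.
apply: (@le_trans _ _ (\sum_(u < K) G%:R ^+ T / T`!%:R * ((2 ^ (4 * G))%:R * 2%:R^-1 ^+ u))).
  by apply: ler_sum => u _; apply: term.
rewrite -!mulr_sumr ler_wpM2l ?divr_ge0 ?exprn_ge0 // expnSr natrM ler_wpM2l //.
have geo : \sum_(u < K) 2%:R^-1 ^+ u = 2%:R - 2%:R * 2%:R^-1 ^+ K :> R.
  elim: K => [|K IHK]; first by rewrite big_ord0 expr0 mulr1 subrr.
  rewrite big_ord_recr /= IHK exprS mulrA divff ?pnatr_eq0 // mul1r.
  ring.
by rewrite geo lerBlDr lerDl mulr_ge0 ?exprn_ge0 // invr_ge0.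
Qed.
End Tail.

(** A value of [h] admissible in [siegel_lemma] for [m * P] unknowns, with [P = e * n], and
    [(m * e - 1) * n] equations, hence [n] unknowns to spare. *)
Definition siegel_height (m P B e : nat) := ((3 * (m * P) * B) ^ (m * e))%N.

(** With [Z = 3 m e n B] and [T] equations it suffices that [(Z h)^T < h^(T + n)], that is
    [Z^T < h^n = Z^(T + n)]. *)
Lemma siegel_height_large (m e n B : nat) : (0 < m)%N -> (0 < e)%N -> (0 < n)%N -> (0 < B)%N ->
  ((2 * (m * (e * n) * B * siegel_height m (e * n) B e)).+1 ^ ((m * e - 1) * n) <
    siegel_height m (e * n) B e ^ (m * (e * n)))%N.
Proof.
move=> m0 e0 n0 B0; set h := siegel_height _ _ _ _; set T := ((m * e - 1) * n)%N.
have me0 : (0 < m * e)%N by rewrite muln_gt0 m0.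
have qE : (m * (e * n) = T + n)%N.
  by rewrite mulnA /T mulnBl mul1n subnK // leq_pmull.
rewrite [X in (2 * (X * _ * _))%N]qE [X in (_ < h ^ X)%N]qE.
set Z := (3 * (m * (e * n)) * B)%N.
have Z1 : (1 < Z)%N by rewrite /Z qE; nia.
have hE : h = (Z ^ (m * e))%N by [].
have h0 : (0 < h)%N by rewrite hE expn_gt0 (ltnW Z1).
apply: (@leq_ltn_trans ((Z * h) ^ T)); last first.
  have hT0 : (0 < h ^ T)%N by rewrite expn_gt0 h0.
  rewrite (expnMn Z h) (expnD h) mulnC (ltn_pmul2l hT0) hE -expnM ltn_exp2l //.
  by rewrite -mulnA qE -[X in (X < _)%N]addn0 ltn_add2l.
have le : ((2 * ((T + n) * B * h)).+1 <= Z * h)%N.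
  have : (0 < (T + n) * B * h)%N by rewrite !muln_gt0 addn_gt0 n0 orbT B0 h0.
  by rewrite /Z qE; lia.
by have [T0|T0] := posnP T; [rewrite [in X in (_ ^ X <= _)%N]T0 T0 | rewrite leq_exp2r].
Qed.

Lemma sum_coef_poly_mul (R : nzRingType) (P t : nat) (F G : nat -> R) :
  \sum_(l < t.+1) (\poly_(j < P) F j)`_l * G l =
  \sum_(l < P) (if (l <= t)%N then F l * G l else 0).
Proof.
rewrite (big_ord_widen (t.+1 + P) (fun l => (\poly_(j < P) F j)`_l * G l)) ?leq_addr //.
rewrite (big_ord_widen (t.+1 + P) (fun l => if (l <= t)%N then F l * G l else 0)) ?leq_addl //.
rewrite !(big_mkcond (fun l : 'I__ => (_ l < _)%N)); apply: eq_bigr => l _ /=.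
by rewrite coef_poly ltnS; do 2!case: ifP; rewrite ?mul0r.
Qed.

(** * Construction of the approximating form *)

Section LinearIndependence.
Variables (R : realType) (M : nat) (k : 'I_M -> nat) (N : 'M[R]_M) (rk : 'I_M -> nat).
Variables (Y : 'I_M -> nat -> R) (y : 'I_M -> R) (D C : nat).
Hypothesis Yrec : forall a t,
  Y a t *+ t = (k a)%:R * (if t is t'.+1 then Y a t' else 0) + \sum_b N a b * Y b t.
Hypothesis Y_le : forall a t, `|Y a t| <= D%:R ^+ t / t`!%:R.
Hypotheses (D_gt0 : (0 < D)%N) (C_gt0 : (0 < C)%N).
Hypothesis Y_den : forall T, exists2 d : nat, (0 < d <= C ^ T)%N &
  forall a t, (t <= T)%N -> d%:R * (t`!%:R * Y a t) \is a Num.int.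

(** With unknowns [x] in the coefficients [P! / l! * x], the equations multiplied by [d t! / P!]
    acquire the integer coefficients [Er], which grow only exponentially. The decay in [1 / l!]
    serves the later bound on the values. *)
Lemma exists_approximant e n : (0 < M)%N -> (0 < e)%N -> (0 < n)%N ->
  let P := (e * n)%N in let T := ((M * e - 1) * n)%N in
  let h := siegel_height M P ((2 * C * D) ^ T) e in
  exists L : 'rV[{poly R}]_M, [/\ L != 0, forall b, (size (L 0%R b) <= P)%N,
    forall b l, (L 0 b)`_l \is a Num.int,
    forall b l, `|(L 0 b)`_l| <= (P`! * h)%N%:R / l`!%:R &
    forall t, (t < T)%N -> series_coef Y L t = 0].
Proof.
move=> M0 e0 n0 P T h; have f0 v : 0 < v`!%:R :> R by rewrite ltr0n fact_gt0.
have [d /andP[d_gt0 d_le] dP] := Y_den T.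
pose Er (bl : 'I_M * 'I_P) (t : 'I_T) : R :=
  if (bl.2 <= t)%N then 'C(t, bl.2)%:R * (d%:R * ((t - bl.2)`!%:R * Y bl.1 (t - bl.2)%N)) else 0.
have Er_int bl t : Er bl t \is a Num.int.
  rewrite /Er; case: ifP => // _; rewrite rpredM ?rpred_nat // dP //.
  by apply: leq_trans (leq_subr _ _) _; apply: ltnW.
pose E bl t : int := Num.floor (Er bl t).
have EE bl t : (E bl t)%:~R = Er bl t by apply: floorK.
have E_le bl t : (`|E bl t|%N <= (2 * C * D) ^ T)%N.
  rewrite -(ler_nat R) natr_absz intr_norm EE /Er.
  case: ifP => [le_lt|_]; last by rewrite normr0.
  set s := (t - bl.2)%N; have le_sT : (s <= T)%N.
    by apply: leq_trans (leq_subr _ _) _; apply: ltnW.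
  rewrite !normrM !normr_nat -mulnA expnMn natrM; apply: ler_pM; rewrite ?mulr_ge0 //.
    rewrite ler_nat; apply: leq_trans (leq_bin_exp2 _ _) _.
    by rewrite leq_exp2l // ltnW.
  rewrite expnMn natrM; apply: ler_pM; rewrite ?mulr_ge0 //; first by rewrite ler_nat.
  apply: (@le_trans _ _ (D%:R ^+ s)).
    by rewrite mulrC -ler_pdivlMr.
  by rewrite -natrX ler_nat leq_pexp2l.
have B0 : (0 < (2 * C * D) ^ T)%N by rewrite expn_gt0 !muln_gt0 C_gt0 D_gt0.
have [|x [[bl0 xbl0] x_le xE]] := siegel_lemma (h := h) E_le.
  by rewrite card_prod !card_ord; apply: siegel_height_large.
pose c b l : R := P`!%:R / l`!%:R * oapp (fun l' : 'I_P => (x (b, l'))%:~R) 0 (insub l).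
exists (\row_b \poly_(l < P) c b l); split.
- apply/eqP => /rowP /(_ bl0.1) /polyP /(_ bl0.2); rewrite !mxE coef0 coef_poly ltn_ord.
  rewrite /c valK /= -surjective_pairing => /eqP.
  by rewrite mulf_eq0 intr_eq0 (negPf xbl0) orbF gt_eqF // divr_gt0.
- by move=> b; rewrite mxE size_poly.
- move=> b l; rewrite mxE coef_poly; case: ifP => // lt_lP.
  rewrite /c insubT rpredM ?rpred_int //= -(bin_fact (ltnW lt_lP)).
  by rewrite mulnCA natrM mulrAC divff ?gt_eqF // mul1r rpred_nat.
- move=> b l; rewrite mxE coef_poly; case: ifP => lt_lP; last first.
    by rewrite normr0 divr_ge0.
  rewrite /c insubT /= normrM natrM -mulrA [h%:R / _]mulrC mulrA.
  rewrite [X in X * _]ger0_norm ?divr_ge0 // ler_wpM2l ?divr_ge0 //.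
  by rewrite -intr_norm -natr_absz ler_nat.
move=> t lt_tT; have t_ord := Ordinal lt_tT.
apply: (mulfI (_ : d%:R * t`!%:R / P`!%:R != 0 :> R)).
  by rewrite gt_eqF // divr_gt0 // mulr_gt0 // ltr0n.
rewrite mulr0 -[RHS](_ : (\sum_i x i * E i (Ordinal lt_tT))%:~R = 0); last by rewrite xE.
rewrite rmorph_sum /=.
rewrite [RHS](eq_bigr (fun p => (x (p.1, p.2))%:~R * Er (p.1, p.2) (Ordinal lt_tT))); last first.
  by move=> [b l] _; rewrite rmorphM /= EE.
rewrite -(pair_bigA _ (fun b l => (x (b, l))%:~R * Er (b, l) (Ordinal lt_tT))) /=.
rewrite mulr_sumr; apply: eq_bigr => b _; rewrite mulr_sumr /=.
under [in LHS]eq_bigr do rewrite mxE.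
rewrite -[LHS]mulr_sumr; have /= -> := sum_coef_poly_mul P t (c b) (fun l => Y b (t - l)%N).
rewrite mulr_sumr.
apply: eq_bigr => l _; rewrite /Er /=; case: ifP => [le_lt|_]; last by rewrite !mulr0.
rewrite /c valK /= -(bin_fact le_lt) !natrM.
have f1 v : v`!%:R != 0 :> R by rewrite gt_eqF.
by field; rewrite !f1.
Qed.

End LinearIndependence.

(** * Siegel's criterion *)

Lemma norm_det_le (R : numDomainType) n (A : 'M[R]_n) (r s : 'I_n -> R) :
  (forall i j, `|A i j| <= r i * s j) ->
  `|\det A| <= n`!%:R * ((\prod_i r i) * \prod_j s j).
Proof.
move=> A_le; apply: le_trans (ler_norm_sum _ _ _) _.
rewrite mulr_natl -(card_Sn n) -sumr_const; apply: ler_sum => p _.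
rewrite normrM normrX normrN1 expr1n mul1r normr_prod.
rewrite [X in _ <= _ * X](reindex_inj (@perm_inj _ p)) -big_split.
by apply: ler_prod => i _; rewrite normr_ge0 A_le.
Qed.

(** Cramer's rule: the cofactors along the replaced row do not see it. *)
Lemma det_replace_row (R : comNzRingType) n (A : 'M[R]_n) (c : 'rV_n) i0 :
  \det (\matrix_(i, j) if i == i0 then c 0 j else A i j) = (c *m \adj A) 0 i0.
Proof.
rewrite (expand_det_row _ i0) mxE; apply: eq_bigr => j _.
rewrite !mxE eqxx /cofactor; congr (_ * (_ * \det _)).
by apply/matrixP => i l; rewrite !mxE eq_sym (negPf (neq_lift _ _)).
Qed.

Lemma det_replace_col (R : comNzRingType) n (A : 'M[R]_n) (v : 'cV_n) j0 :
  \det (\matrix_(i, j) if j == j0 then v i 0 else A i j) = (\adj A *m v) j0 0.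
Proof.
rewrite (expand_det_col _ j0) mxE; apply: eq_bigr => i _.
rewrite !mxE eqxx /cofactor mulrC; congr (_ * \det _ * _).
by apply/matrixP => l j; rewrite !mxE eq_sym (negPf (neq_lift _ _)).
Qed.

(** For an invertible choice [G] of rows, [c *m \adj G] is nonzero; a nonzero entry [i0] is the
    determinant with row [i0] replaced by [c]. *)
Lemma exists_completing_rows (F : fieldType) m n (A : 'M[F]_(m, n)) (c : 'rV_n) :
  row_full A -> c != 0 ->
  exists (f : 'I_n -> 'I_m) i0,
    \det (\matrix_(i, j) if i == i0 then c 0 j else A (f i) j) != 0.
Proof.
move=> fA c0; pose f := fullrankfun fA; pose G := rowsub f A.
have G_unit : G \in unitmx by apply: fullrowsub_unit.
have /rV0Pn[i0 ci0] : c *m \adj G != 0.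
  apply: contraNneq c0 => cG; move: G_unit; rewrite unitmxE unitfE => detG.
  apply/eqP/(scalemx_inj detG).
  by rewrite -mul_mx_scalar -mul_adj_mx mulmxA cG mul0mx scaler0.
exists f, i0; apply: contraNneq ci0 => detE; rewrite -det_replace_row.
by rewrite -[X in _ == X]detE; apply/eqP; congr (\det _); apply/matrixP => i j; rewrite !mxE.
Qed.

(* Siegel's criterion: a relation [c] among the [y j], completed by [n - 1] of the
   small forms [A i], has a nonzero integer determinant, which becomes small
   once the column of [y b0 = 1] is replaced by the values of the forms. *)

Lemma integer_forms_bound (R : realType) m n (A : 'M[R]_(m, n)) (c : 'rV[R]_n)
    (y : 'cV[R]_n) b0 (H Hc eps : R) :
  (forall i j, A i j \is a Num.int) -> (forall j, c 0 j \is a Num.int) ->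
  row_full A -> c != 0 -> y b0 0 = 1 -> c *m y = 0 ->
  0 < H -> (forall i j, `|A i j| <= H) -> (forall j, `|c 0 j| <= Hc) ->
  (forall i, `|(A *m y) i 0| <= eps) ->
  1 <= n`!%:R * (Hc * H ^+ n.-1 * (eps / H)).
Proof.
move=> A_int c_int fA c0 yb0 cy H0 A_le c_le eps_le.
have [f [i0 det0]] := exists_completing_rows fA c0.
set G := \matrix_(i, j) _ in det0.
have G_int : \det G \is a Num.int.
  apply: rpred_sum => s _; rewrite rpredM ?rpred_sign // rpred_prod // => i _.
  by rewrite mxE; case: ifP.
have Gy i : (G *m y) i 0 = if i == i0 then 0 else (A *m y) (f i) 0.
  rewrite mxE; case: ifP => [/eqP->|ni].
    rewrite -[RHS](_ : (c *m y) 0 0 = 0); last by rewrite cy mxE.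
    by rewrite mxE; apply: eq_bigr => j _; rewrite mxE eqxx.
  by rewrite mxE; apply: eq_bigr => j _; rewrite mxE ni.
have detE : \det G = \det (\matrix_(i, j) if j == b0 then (G *m y) i 0 else G i j).
  by rewrite det_replace_col mulmxA mul_adj_mx mul_scalar_mx mxE yb0 mulr1.
apply: le_trans (norm_intr_ge1 G_int det0) _; rewrite {}detE.
have eps0 : 0 <= eps by apply: le_trans (eps_le (f i0)).
have Hc0 : 0 <= Hc by apply: le_trans (c_le b0).
(* Row [i0] is bounded by [Hc] and the others by [H]; the column weight lowers [H] to [eps] in
   column [b0], whose entry in row [i0] is 0. *)
pose r i := if i == i0 then Hc else H.
pose s j := if j == b0 then eps / H else 1.
have -> : Hc * H ^+ n.-1 * (eps / H) = (\prod_i r i) * \prod_j s j.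
  congr (_ * _).
    rewrite (bigD1 i0) //= {1}/r eqxx; congr (_ * _).
    rewrite (eq_bigr (fun=> H)) => [|i /negPf ni]; last by rewrite /r ni.
    by rewrite prodr_const cardC1 card_ord.
  rewrite (bigD1 b0) //= {1}/s eqxx big1 ?mulr1 // => j /negPf nj.
  by rewrite /s nj.
apply: norm_det_le => i j; rewrite mxE /r /s; case: ifP => _; last first.
  by rewrite mulr1 mxE; case: ifP.
rewrite Gy; case: ifP => _; first by rewrite normr0 mulr_ge0 // divr_ge0 // ltW.
by rewrite mulrC divfK ?gt_eqF.
Qed.

(** * Size of the forms at 1 and the final comparison *)

Section LinearIndependence.
Variables (R : realType) (M : nat) (k : 'I_M -> nat) (N : 'M[R]_M) (rk : 'I_M -> nat).
Variables (Y : 'I_M -> nat -> R) (y : 'I_M -> R) (D C : nat).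
Hypothesis Yrec : forall a t,
  Y a t *+ t = (k a)%:R * (if t is t'.+1 then Y a t' else 0) + \sum_b N a b * Y b t.
Hypothesis Y_le : forall a t, `|Y a t| <= D%:R ^+ t / t`!%:R.
Hypothesis Y_cvg : forall a, \sum_(t < K) Y a t @[K --> \oo] --> y a.

(** The coefficients of the [i]-th derivative are those of [L] times [t ^ i], and
    [t ^ i <= i! 2^(i + t)] only doubles the radius [D + 1]. The terms below [T] vanish, leaving an
    exponential tail. *)
Lemma norm_form_value_le (L : 'rV[{poly R}]_M) T i (H : R) : 0 <= H ->
  (forall b l, `|(L 0 b)`_l| <= H / l`!%:R) ->
  (forall t, (t < T)%N -> series_coef Y L t = 0) ->
  `|\sum_b (iter i (delta k N) L 0 b).[1] * y b| <=
    M%:R * H * (i`! * 2 ^ i)%:R *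
    ((2 * D.+1)%:R ^+ T / T`!%:R * (2 ^ (4 * (2 * D.+1)).+1)%:R).
Proof.
move=> H0 L_le L_small; set bound := (X in _ <= X).
have cvgS := cvg_series_coef (w := iter i (delta k N) L) Y_cvg.
apply: (cvgr_to_le (cvg_norm cvgS)); near=> K.
have f0 v : 0 < v`!%:R :> R by rewrite ltr0n fact_gt0.
pose a t := `|series_coef Y L t| * t%:R ^+ i.
have a0 t : 0 <= a t by rewrite mulr_ge0 ?exprn_ge0.
apply: (@le_trans _ _ (\sum_(t < K) a t)).
  apply: le_trans (ler_norm_sum _ _ _) _; apply: ler_sum => t _.
  by rewrite (series_coef_iter Yrec) normrM normrX normr_nat.
apply: (@le_trans _ _ (\sum_(t < K + T) a t)).
  by rewrite big_split_ord /= lerDl sumr_ge0.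
rewrite addnC big_split_ord /= big1 ?add0r => [|t _]; last first.
  by rewrite /a L_small ?normr0 ?mul0r //=.
apply: (@le_trans _ _ (\sum_(u < K) M%:R * H * (i`! * 2 ^ i)%:R *
    ((2 * D.+1)%:R ^+ (T + u) / (T + u)`!%:R))); last first.
  rewrite -mulr_sumr ler_wpM2l ?exp_tail_le // !mulr_ge0 //.
apply: ler_sum => u _ /=; set t := (T + u)%N.
apply: le_trans (ler_pM _ _ (series_coef_le t Y_le L_le) (_ : _ <= (i`! * 2 ^ (i + t))%:R)) _.
- by [].
- by rewrite exprn_ge0.
- by rewrite -natrX ler_nat expn_le_fact.
rewrite expnD natrM natrM natrM natrX !natrX natrM exprMn -!mulrA le_eqVlt; apply/orP; left.
by apply/eqP; ring.
Unshelve. all: by end_near.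
Qed.

Hypotheses (rk_inj : injective rk) (N_lower : forall a b, N a b != 0 -> (rk b < rk a)%N).
Hypothesis N_int : forall a b, N a b \is a Num.int.
Hypothesis leading : forall (c : 'rV[R]_M) j, c != 0 -> c *m N = 0 ->
  (forall b, c 0 b != 0 -> k b = j) -> \sum_b c 0 b * Y b 0%N != 0.
Hypotheses (D_gt0 : (0 < D)%N) (C_gt0 : (0 < C)%N).
Hypothesis Y_den : forall T, exists2 d : nat, (0 < d <= C ^ T)%N &
  forall a t, (t <= T)%N -> d%:R * (t`!%:R * Y a t) \is a Num.int.

Definition form_height (e K0 : nat) n :=
  let P := (e * n)%N in let m := (n + M ^ 2)%N in
  ((P + m) * (P + m + K0) ^ m * (P`! * siegel_height M P ((2 * C * D) ^ ((M * e - 1) * n)) e))%N.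

Lemma iter_delta_int (L : 'rV[{poly R}]_M) i :
  (forall b l, (L 0 b)`_l \is a Num.int) ->
  forall b l, (iter i (delta k N) L 0 b)`_l \is a Num.int.
Proof.
move=> L_int; elim: i => //= i IHi b l.
rewrite mxE !coefD coef_theta coefZ coefXM coef_sum !rpredD ?rpredMn //.
  by rewrite rpredM ?rpred_nat //; case: ifP => _ //; rewrite rpred0.
by apply: rpred_sum => a _; rewrite coefMC rpredM.
Qed.

(** The differentiations contribute [n ^ n] and [P!] contributes [n ^ (e n)]; the height from
    Siegel's lemma is only exponential. *)
Lemma ngrowth_height e K0 : ngrowth (1 + e) (form_height e K0).
Proof.
rewrite /form_height.
have lin (a b : nat) : ngrowth 0 (fun n => a * n + b)%N.
  apply: ngrowth_le (ngrowthM (ngrowth_const (a + b)) ngrowth_id) => n n0.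
  by rewrite mulnDl leq_add2l leq_pmulr.
have -> : (1 + e = (0 + (1 + 0 * K0)) + (e + (M * e) * (0 + 0)))%N by lia.
apply: ngrowthM; [apply: ngrowthM|apply: ngrowthM; last apply: ngrowthX].
- by apply: ngrowth_le (lin e.+1 (M ^ 2)%N) => n _; rewrite mulSn; lia.
- apply: ngrowth_le (ngrowth_lin_exp (e.+1 + M ^ 2 + K0) 1 (M ^ 2)) => n n0.
  rewrite mul1n; have [->//|m0] := posnP (n + M ^ 2).
  by rewrite leq_exp2r //; nia.
- by apply: ngrowth_le (ngrowth_fact e 0) => n _; rewrite addn0.
- apply: ngrowthM.
    by apply: ngrowth_le (lin (3 * (M * e))%N 0%N) => n _; lia.
  by apply: ngrowth_le (ngrowth_exp (2 * C * D) (M * e - 1) 0) => n _; rewrite addn0.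
Qed.

(* For [e = M + 1] and [T = (M * e - 1) * n], up to factors [exp (O(n))], the integer
   forms at 1 have coefficients [n ^ ((e + 1) * n)] and values
   [n ^ ((e + 1) * n) / T`!], so the determinant in Siegel's criterion is at most
   [n ^ ((M - 1) * (e + 1) * n) / T`! = n ^ (- n)]. *)
Theorem integer_relation_trivial (c : 'rV[R]_M) b0 :
  (1 < M)%N -> Y b0 0%N != 0 -> y b0 = 1 -> (forall b, c 0 b \is a Num.int) ->
  c *m (\col_b y b) = 0 -> c = 0.
Proof.
move=> M1 Yb0 yb0 c_int cy; apply/eqP; apply: contraT => c0.
(* This [e] makes the exponent [(M - 2) (1 + e) + e + 2] of the final comparison equal to
   [M e - 1]. *)
have M0 := ltnW M1; pose e := M.+1.
have nat_ge (I : finType) (F : I -> R) : (forall i, 0 <= F i) ->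
    exists K : nat, forall i, F i <= K%:R.
  move=> F0; exists (Num.Def.archi_bound (\sum_i F i)) => i.
  apply/ltW; apply: le_lt_trans (archi_boundP _); last exact: sumr_ge0.
  by rewrite (bigD1 i) //= lerDl sumr_ge0.
have [K0 K0P] : exists K0 : nat, forall b, (k b)%:R + \sum_a `|N a b| <= K0%:R.
  by apply: nat_ge => b; rewrite addr_ge0 ?sumr_ge0.
have [Hc HcP] : exists Hc : nat, forall b, `|c 0 b| <= Hc%:R by apply: nat_ge.
pose G := (2 * D.+1)%N.
pose h n := (siegel_height M (e * n) ((2 * C * D) ^ ((M * e - 1) * n)) e)%N.
(* [W n / T!] will bound the values of the forms, and [form_height] their coefficients. *)
pose W n := (M * ((e * n)`! * h n) * ((n + M ^ 2)`! * 2 ^ (n + M ^ 2)) *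
   (G ^ ((M * e - 1) * n) * 2 ^ (4 * G).+1))%N.
pose g n := (M`! * (Hc * form_height e K0 n ^ (M - 2) * W n) * 4 ^ ((M * e - 1) * n))%N.
have g_growth : ngrowth ((M - 2) * (1 + e) + e + 1) g.
  have -> : ((M - 2) * (1 + e) + e + 1 =
      0 + (0 + (M - 2) * (1 + e) + (0 + (e + (M * e) * (0 + 0)) + (1 + 0) + (0 + 0))) + 0)%N by lia.
  have pow a b : ngrowth 0 (fun n => a ^ (b * n))%N.
    by apply: ngrowth_le (ngrowth_exp a b 0) => n _; rewrite addn0.
  apply: ngrowthM; last exact: pow.
  apply: ngrowthM; first exact: ngrowth_const.
  apply: ngrowthM.
    apply: ngrowthM; first exact: ngrowth_const.
    apply: ngrowthX; exact: ngrowth_height.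
  apply: ngrowthM; [apply: ngrowthM; [apply: ngrowthM|apply: ngrowthM]|apply: ngrowthM].
  - exact: ngrowth_const.
  - apply: ngrowthM.
      by apply: ngrowth_le (ngrowth_fact e 0) => n _; rewrite addn0.
    apply: ngrowthX; apply: ngrowthM; last exact: pow.
    apply: ngrowth_le (ngrowthM (ngrowth_const (3 * (M * e))) ngrowth_id) => n _; lia.
  - by apply: ngrowth_le (ngrowth_fact 1 (M ^ 2)) => n _; rewrite mul1n.
  - by apply: ngrowth_le (ngrowth_exp 2 1 (M ^ 2)) => n _; rewrite mul1n.
  - exact: pow.
  exact: ngrowth_const.
have [n n_large /andP[n0 g_lt]] := ngrowth_beaten (M ^ 2) g_growth.
have aE : (((M - 2) * (1 + e) + e + 1).+1 = M * e - 1)%N by rewrite /e; nia.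
rewrite {}aE in g_lt.
set T := ((M * e - 1) * n)%N in g_lt.
have TE : (T + n = M * (e * n))%N.
  by rewrite /T mulnBl mul1n mulnA subnK // leq_pmull // muln_gt0 M0.
have le_nT : (n <= T)%N by rewrite leq_pmull // /e; nia.
(* As [n <= T], one has [n ^ T <= T ^ T <= 4 ^ T * T!]; the factor [4 ^ T] in [g] is there to be
   cancelled here. *)
have lt_fact : (M`! * (Hc * form_height e K0 n ^ (M - 2) * W n) < T`!)%N.
  rewrite -(@ltn_pmul2r (4 ^ T)) ?expn_gt0 //; apply: leq_trans g_lt _.
  apply: (@leq_trans (T ^ T)).
    by have [->//|T0] := posnP T; rewrite leq_exp2r.
  by apply: leq_trans (expn_le_fact T T) _; rewrite addnn -mul2n (expnM 2 2).
have [L [L0 sL L_int L_le L_small]] := exists_approximant Y_le D_gt0 C_gt0 Y_den M0 (ltn0Sn M) n0.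
rewrite -/e -/T -/(h n) in sL L_le L_small.
set P := (e * n)%N in sL L_le.
have P0 : (0 < P)%N by rewrite muln_gt0.
have sL' b : (size (L 0%R b) <= P.-1.+1)%N by rewrite prednK.
have L_dvd : 'X^T %| trunc_eval Y T L.
  by apply/dvdpXnP => t lt_tT; rewrite coef_trunc_eval // L_small.
(* Since [T = M P - n] and [P = n + M n], the inequality needed is [(M - 1)^2 < M n], which follows
   from [M ^ 2 <= n]. *)
have detL : \det (iterates k N L M) != 0.
  apply: (det_iterates_neq0 Yrec rk_inj N_lower leading L0 sL' L_dvd).
  have : (M.-1 * (P.-1 + M) + M.-1 = M.-1 * P + M.-1 * M)%N.
    by rewrite addnC -mulnS -addSn (prednK P0) mulnDr.
  have : (M.-1 * P + P = M * P)%N by rewrite addnC -mulSn (prednK M0).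
  have : (P = n + M * n)%N by rewrite /P /e mulSn.
  have : (n <= M * n)%N by rewrite leq_pmull.
  have : (M.-1 * M <= M * M)%N by rewrite leq_mul // leq_pred.
  move: n_large M1 TE; rewrite -mulnn -/P; clear; lia.
have := row_full_at1_iterates Yrec sL' L_dvd Yb0 detL.
set m := (M + _)%N => fullL.
have le_m : (m <= n + M ^ 2)%N.
  have : (M * (P.-1 + M) + M = M * P + M * M)%N.
    by rewrite addnC -mulnS -addSn (prednK P0) mulnDr.
  have : (M <= M * M)%N by rewrite leq_pmull.
  by rewrite /m -mulnn; move: TE; rewrite -/P; clear; lia.
set A := at1 _ in fullL.
have AE i j : A i j = (iter i (delta k N) L 0 j).[1] by rewrite !mxE /horner_eval.
have le_im (i : 'I_m) : (i <= n + M ^ 2)%N by apply: leq_trans le_m; apply: ltnW.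
have L_le' b l : `|(L 0 b)`_l| <= (P`! * h n)%N%:R.
  apply: le_trans (L_le b l) _; rewrite ler_pdivrMr ?ltr0n ?fact_gt0 //.
  by rewrite -natrM ler_nat leq_pmulr // fact_gt0.
have A_le i j : `|A i j| <= (form_height e K0 n)%:R.
  rewrite AE; apply: (le_trans (norm_at1_le (S := P + (n + M ^ 2))
    (H := ((P + (n + M ^ 2) + K0) ^ (n + M ^ 2) * (P`! * h n))%N%:R) _ _)).
  - apply: leq_trans (size_iterates _ _ sL' _ _) _.
    by rewrite -addSn prednK // leq_add2l.
  - move=> l; apply: le_trans (coef_iter_delta_le K0P sL' L_le' (le_im i) _ _) _.
    rewrite -natrX -natrM ler_nat leq_mul //.
    apply: (@leq_trans ((P + (n + M ^ 2) + K0) ^ i)).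
      have [->//|i0] := posnP i; rewrite leq_exp2r // !leq_add2r; exact: leq_pred.
    by rewrite leq_pexp2l // addn_gt0 addn_gt0 P0.
  by rewrite -natrM mulnA; apply: lexx.
have eps_le i : `|(A *m (\col_b y b)) i 0| <= (W n)%:R / T`!%:R.
  rewrite mxE (eq_bigr (fun b => (iter i (delta k N) L 0 b).[1] * y b)); last first.
    by move=> b _; rewrite AE mxE.
  apply: le_trans (norm_form_value_le _ _ L_le L_small) _ => //.
  rewrite [leLHS](_ : _ = (M * (P`! * h n) * (i`! * 2 ^ i) *
      (G ^ T * 2 ^ (4 * G).+1))%N%:R / T`!%:R); last first.
    by rewrite /G !natrM !natrX !natrM; ring.
  rewrite ler_wpM2r ?invr_ge0 // ler_nat leq_mul // leq_mul // leq_mul //.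
    by rewrite leq_fact.
  by rewrite leq_exp2l.
have X0 : (0 < form_height e K0 n)%N.
  rewrite /form_height -/P /siegel_height !(muln_gt0, expn_gt0, addn_gt0, fact_gt0).
  by rewrite ?P0 M0 n0 C_gt0 D_gt0 ?orbT.
have A_int i j : A i j \is a Num.int.
  rewrite AE horner_coef; apply: rpred_sum => l _.
  by rewrite expr1n mulr1 iter_delta_int.
have yb0' : (\col_b y b) b0 0 = 1 by rewrite mxE.
have X0' : 0 < (form_height e K0 n)%:R :> R by rewrite ltr0n.
have := integer_forms_bound A_int c_int fullL c0 yb0' cy X0' A_le HcP eps_le.
set X := form_height e K0 n in X0 X0' lt_fact *.
have -> : M.-1 = (M - 2).+1 by move: M1; clear; lia.
have cancel (u v x w t z : R) : x != 0 -> u * (v * (z * x) * (w * t / x)) = u * (v * z * w) * t.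
  by move=> x0; field.
rewrite exprSr cancel ?gt_eqF // -natrX -!natrM.
rewrite ler_pdivlMr ?ltr0n ?fact_gt0 // mul1r ler_nat leqNgt.
by rewrite lt_fact.
Qed.

End LinearIndependence.

(** * The eta series *)

Section EtaSeries.
Variable R : realType.
Implicit Types (p q : {poly R}).

(* [eta_coef 0] gives the exponential series; for [j > 0] the junk value [0^-1 = 0]
   makes the constant coefficient vanish. *)
Definition eta_coef (j t : nat) : R := (t%:R ^+ j * t`!%:R)^-1.

Definition eta_poly K j : {poly R} := \poly_(t < K) eta_coef j t.

Lemma fact_gt0R t : 0 < t`!%:R :> R.
Proof. by rewrite ltr0n fact_gt0. Qed.

Lemma eta_coef_ge0 j t : 0 <= eta_coef j t.
Proof. by rewrite invr_ge0 mulr_ge0 ?exprn_ge0. Qed.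

Lemma eta_coef_le j t : eta_coef j t <= t`!%:R^-1.
Proof.
case: t => [|t]; first by case: j => [|j]; rewrite /eta_coef ?expr0 ?mul1r // expr0n mul0r invr0 invr_ge0.
rewrite lef_pV2 ?posrE ?mulr_gt0 ?exprn_gt0 ?fact_gt0R ?ltr0n //.
by rewrite ler_peMl // exprn_ege1 // ler1n.
Qed.

Lemma eta_coefS j t : eta_coef j.+1 t *+ t = if t is 0%N then 0 else eta_coef j t.
Proof.
case: t => [|t]; first by rewrite mulr0n.
rewrite /eta_coef -[LHS]mulr_natl exprS -mulrA invfM mulrA divff ?mul1r //.
by rewrite pnatr_eq0.
Qed.

Lemma eta_coef00 : eta_coef 0 0 = 1.
Proof. by rewrite /eta_coef expr0 mul1r invr1. Qed.

Lemma eta_coefS0 j : eta_coef j.+1 0 = 0.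
Proof. by rewrite /eta_coef expr0n mul0r invr0. Qed.

Lemma eta_coef0S t : eta_coef 0 t.+1 *+ t.+1 = eta_coef 0 t.
Proof.
rewrite /eta_coef !expr0 !mul1r -[LHS]mulr_natl factS natrM invfM mulrA divff ?mul1r //.
by rewrite pnatr_eq0.
Qed.

Lemma theta_eta_polyS K j :
  theta (eta_poly K.+1 j.+1) = eta_poly K.+1 j - (j == 0%N)%:R%:P.
Proof.
apply/polyP => t; rewrite coef_theta coefB coefC !coef_poly.
case: ltnP => [_|lt_Kt].
  rewrite eta_coefS; case: t => [|t] /=; last by rewrite subr0.
  by case: j => [|j]; rewrite ?eta_coef00 ?eta_coefS0 subrr.
by rewrite mul0rn; case: t lt_Kt => // t _; rewrite subr0.
Qed.

Lemma theta_eta_poly0 K : 'X^K %| theta (eta_poly K 0) - 'X * eta_poly K 0.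
Proof.
apply/dvdpXnP => t lt_tK; rewrite coefB coef_theta coefXM !coef_poly lt_tK.
case: t lt_tK => [|t] lt_tK; first by rewrite mulr0n subrr.
by rewrite (ltnW lt_tK) eta_coef0S subrr.
Qed.

(** * Monomials in the eta series: size, denominators, recursion, values *)

Section Monomials.
Variable n : nat.
Implicit Types a : 'I_n.+1 -> nat.

Definition eta_monom K a : {poly R} := \prod_(j < n.+1) eta_poly K j ^+ a j.

(** The coefficient of [z^t] in the product of the full series; by [coef_eta_monom] any longer
    truncation gives the same number. *)
Definition eta_monom_coef a t : R := (eta_monom t.+1 a)`_t.

Lemma dvdp_prod_sub T (I : finType) (F G : I -> {poly R}) :
  (forall i, 'X^T %| F i - G i) -> 'X^T %| \prod_i F i - \prod_i G i.
Proof.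
move=> FG; elim/big_rec2: _ => [|i p q _ pq /=]; first by rewrite subrr dvdp0.
have -> : F i * q - G i * p = (F i - G i) * q + G i * (q - p) by ring.
by apply: dvdp_add; [apply: dvdp_mulr|apply: dvdp_mull].
Qed.

Lemma dvdp_exp_sub T p q k : 'X^T %| p - q -> 'X^T %| p ^+ k - q ^+ k.
Proof.
by move=> pq; rewrite -(card_ord k) -!prodr_const; apply: dvdp_prod_sub.
Qed.

Lemma coef_eta_monom K a t : (t < K)%N -> (eta_monom K a)`_t = eta_monom_coef a t.
Proof.
move=> lt_tK; apply/eqP; rewrite -subr_eq0 -coefB; apply/eqP.
suff /dvdpXnP/(_ t (ltnSn t)) : 'X^(t.+1) %| eta_monom K a - eta_monom t.+1 a by [].
apply: dvdp_prod_sub => j; apply: dvdp_exp_sub; apply/dvdpXnP => s lt_st.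
by rewrite coefB !coef_poly lt_st (leq_trans lt_st lt_tK) subrr.
Qed.

(** Majorization by [exp(cz)], which turns products into sums of the parameters. *)
Definition egf_le c p := forall t, 0 <= p`_t <= c%:R ^+ t / t`!%:R.

Lemma egf_le1 : egf_le 0 1.
Proof.
case=> [|t]; first by rewrite coef1 expr0 fact0 divr1 ler01 lexx.
by rewrite coef1 expr0n /= mul0r lexx.
Qed.

Lemma egf_leM c d p q : egf_le c p -> egf_le d q -> egf_le (c + d) (p * q).
Proof.
move=> cp dq t; rewrite coefM; apply/andP; split.
  apply: sumr_ge0 => l _; have /andP[p0 _] := cp l; have /andP[q0 _] := dq (t - l)%N.
  exact: mulr_ge0.
apply: (@le_trans _ _ (\sum_(l < t.+1) (c%:R ^+ l / l`!%:R) * (d%:R ^+ (t - l) / (t - l)`!%:R))).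
  apply: ler_sum => l _; have /andP[p0 p1] := cp l; have /andP[q0 q1] := dq (t - l)%N.
  exact: ler_pM.
rewrite [in leRHS]addnC natrD exprDn mulr_suml le_eqVlt; apply/orP; left; apply/eqP.
apply: eq_bigr => l _; have le_lt : (l <= t)%N by rewrite -ltnS.
rewrite -(bin_fact le_lt) !natrM -mulr_natr.
have C0 : 'C(t, l)%:R != 0 :> R by rewrite pnatr_eq0 -lt0n bin_gt0.
have f0 v : v`!%:R != 0 :> R by rewrite gt_eqF ?fact_gt0R.
by field; rewrite C0 !f0.
Qed.

Lemma egf_le_prod (I : finType) (c : I -> nat) (F : I -> {poly R}) :
  (forall i, egf_le (c i) (F i)) -> egf_le (\sum_i c i) (\prod_i F i).
Proof. by move=> cF; apply: (big_ind2 egf_le) => // [|d q e r]; [apply: egf_le1|apply: egf_leM]. Qed.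

Lemma egf_le_exp c p k : egf_le c p -> egf_le (k * c) (p ^+ k).
Proof.
move=> cp; rewrite -{2}(card_ord k) -prodr_const -{1}(card_ord k) -sum_nat_const.
exact: egf_le_prod.
Qed.

Lemma egf_le_monom K a : egf_le (\sum_j a j) (eta_monom K a).
Proof.
apply: egf_le_prod => j; rewrite -[X in egf_le X _]muln1; apply: egf_le_exp => t.
rewrite coef_poly expr1n mul1r; case: ifP => _; first by rewrite eta_coef_ge0 eta_coef_le.
by rewrite lexx invr_ge0 ler0n.
Qed.

Lemma eta_monom_coef_ge0 a t : 0 <= eta_monom_coef a t.
Proof. by have /andP[] := egf_le_monom t.+1 a t. Qed.

Lemma eta_monom_coef_le d a t : (\sum_j a j <= d)%N ->
  `|eta_monom_coef a t| <= d%:R ^+ t / t`!%:R.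
Proof.
move=> le_ad; rewrite ger0_norm ?eta_monom_coef_ge0 //.
have /andP[_ le] := egf_le_monom t.+1 a t; apply: le_trans le _.
by rewrite ler_wpM2r ?invr_ge0 // lerXn2r ?nnegrE ?ler_nat.
Qed.

(** Up to order [T], the exponential coefficients [t! p_t] have denominators dividing [c ^ e];
    binomial convolution preserves this, adding the exponents. *)
Definition egf_int T c e p :=
  forall t, (t <= T)%N -> c%:R ^+ e * (t`!%:R * p`_t) \is a Num.int.

Lemma egf_int1 T c : egf_int T c 0 1.
Proof. by move=> t _; rewrite coef1 expr0 mul1r -natrM rpred_nat. Qed.

Lemma egf_intM T c d e p q :
  egf_int T c d p -> egf_int T c e q -> egf_int T c (d + e) (p * q).
Proof.
move=> cp dq t le_tT; rewrite coefM !mulr_sumr; apply: rpred_sum => l _.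
have le_lt : (l <= t)%N by rewrite -ltnS.
have -> : c%:R ^+ (d + e) * (t`!%:R * (p`_l * q`_(t - l))) = 'C(t, l)%:R *
   ((c%:R ^+ d * (l`!%:R * p`_l)) * (c%:R ^+ e * ((t - l)`!%:R * q`_(t - l)))).
  by rewrite -(bin_fact le_lt) !natrM exprD; ring.
have lT : (l <= T)%N by apply: leq_trans le_tT.
have tlT : (t - l <= T)%N by apply: leq_trans le_tT; apply: leq_subr.
by apply: rpredM; [apply: rpred_nat|apply: rpredM; [apply: cp|apply: dq]].
Qed.

Lemma egf_int_prod T c (I : finType) (e : I -> nat) (F : I -> {poly R}) :
  (forall i, egf_int T c (e i) (F i)) -> egf_int T c (\sum_i e i) (\prod_i F i).
Proof.
by move=> cF; apply: (big_ind2 (egf_int T c)) => // [|d q e' r]; [apply: egf_int1|apply: egf_intM].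
Qed.

Lemma egf_int_exp T c e p k : egf_int T c e p -> egf_int T c (k * e) (p ^+ k).
Proof.
move=> cp; rewrite -{2}(card_ord k) -prodr_const -{1}(card_ord k) -sum_nat_const.
exact: egf_int_prod.
Qed.

Lemma egf_int_eta_poly T c K j : (j <= n)%N -> (forall k, (0 < k <= T)%N -> (k %| c)%N) ->
  egf_int T c n (eta_poly K j).
Proof.
move=> le_jn dvd_c t le_tT; rewrite coef_poly; case: ifP => _; last by rewrite !mulr0 rpred0.
rewrite /eta_coef invfM [X in _ * X]mulrC divfK ?gt_eqF ?fact_gt0R //.
(* At [t = 0] the coefficient is 1 or the default value 0; otherwise it is [t^-j], cleared by
   [c ^ n]. *)
case: t le_tT => [|t] le_tT.
  by case: j {le_jn} => [|j]; rewrite ?expr0 ?expr0n ?invr1 ?invr0 ?mulr1 ?mulr0 ?rpredX ?rpred_nat ?rpred0.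
have /dvdnP[m ->] := dvd_c t.+1 le_tT.
rewrite -(subnK le_jn) exprD -mulrA -expr_div_n rpredM ?rpredX ?rpred_nat //.
by rewrite natrM mulfK ?pnatr_eq0 // rpred_nat.
Qed.

Lemma eta_monom_coef_int d T c a : (\sum_j a j <= d)%N ->
  (forall k, (0 < k <= T)%N -> (k %| c)%N) -> forall t, (t <= T)%N ->
  (c ^ (d * n))%N%:R * (t`!%:R * eta_monom_coef a t) \is a Num.int.
Proof.
move=> le_ad dvd_c t le_tT.
have intE : egf_int T c (\sum_j a j * n)%N (eta_monom t.+1 a).
  apply: egf_int_prod => j; apply/egf_int_exp/egf_int_eta_poly => //.
  by rewrite -ltnS.
rewrite -(subnK le_ad) mulnDl expnD natrM -mulrA rpredM ?rpred_nat // natrX.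
by rewrite big_distrl; apply: intE.
Qed.

Lemma theta_prod m (G : 'I_m -> {poly R}) :
  theta (\prod_i G i) = \sum_j \prod_i (if i == j then theta (G i) else G i).
Proof.
elim: m G => [|m IHm] G; first by rewrite !big_ord0 thetaC.
rewrite big_ord_recl thetaM IHm [RHS]big_ord_recl; congr (_ + _).
  by rewrite [RHS]big_ord_recl eqxx.
rewrite mulr_sumr; apply: eq_bigr => j _; rewrite [RHS]big_ord_recl.
by rewrite (negPf (neq_lift _ _)); congr (_ * _); apply: eq_bigr => i _.
Qed.

Definition raise j a : 'I_n.+1 -> nat := fun i => (a i + (i == j))%N.
(** When [a j = 0] the truncated subtraction changes nothing; the factor [a j] of the product rule
    removes such terms. *)
Definition lower j a : 'I_n.+1 -> nat := fun i => (a i - (i == j))%N.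

Lemma eq_eta_monom_coef a b t : a =1 b -> eta_monom_coef a t = eta_monom_coef b t.
Proof.
move=> ab; rewrite /eta_monom_coef; congr (polyseq _)`_t.
by apply: eq_bigr => j _; rewrite ab.
Qed.

Lemma eta_monom_raise K j a : eta_monom K (raise j a) = eta_poly K j * eta_monom K a.
Proof.
rewrite /eta_monom (bigD1 j) //= [in RHS](bigD1 j) //= /raise eqxx addn1 exprS -mulrA.
by congr (_ * (_ * _)); apply: eq_bigr => i /negPf->; rewrite addn0.
Qed.

Lemma theta_eta_monom K a :
  theta (eta_monom K a) =
  \sum_j (a j)%:R *: (theta (eta_poly K j) * eta_monom K (lower j a)).
Proof.
rewrite theta_prod; apply: eq_bigr => j _.
rewrite (bigD1 j) //= eqxx /eta_monom [in RHS](bigD1 j) //= /lower eqxx.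
rewrite (eq_bigr (fun i : 'I__ => eta_poly K i ^+ a i)) => [|i /negPf-> //].
rewrite [in RHS](eq_bigr (fun i : 'I__ => eta_poly K i ^+ a i)) => [|i /negPf->]; last first.
  by rewrite subn0.
case: (a j) => [|k]; first by rewrite expr0 thetaC mul0r scale0r.
by rewrite thetaXn subn1 /= -mul_polyC polyC_natr -mulr_natl; ring.
Qed.

(** The product rule: [theta] reproduces each factor [F_0] times [z], and trades a factor [F_(j+1)]
    for [F_j], minus 1 if [j = 0]. *)
Lemma eta_monom_coef_rec a t : eta_monom_coef a t *+ t =
  (a ord0)%:R * (if t is t'.+1 then eta_monom_coef a t' else 0) +
  \sum_(j < n) (a (lift ord0 j))%:R *
    (eta_monom_coef (raise (widen_ord (leqnSn n) j) (lower (lift ord0 j) a)) t -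
     (j == 0%N :> nat)%:R * eta_monom_coef (lower (lift ord0 j) a) t).
Proof.
rewrite -coef_theta theta_eta_monom coef_sum big_ord_recl; congr (_ + _).
  rewrite coefZ; case a0 : (a ord0) => [|k]; first by rewrite !mul0r.
  congr (_ * _).
  have E : eta_poly t.+1 0 * eta_monom t.+1 (lower ord0 a) = eta_monom t.+1 a.
    rewrite -(eta_monom_raise t.+1 ord0); apply: eq_bigr => i _; congr (_ ^+ _).
    by rewrite /raise /lower; case: eqP => [->|_]; rewrite ?subn0 ?addn0 // a0 subn1 addn1.
  transitivity ('X * eta_monom t.+1 a)`_t.
    apply/eqP; rewrite -subr_eq0 -coefB -E mulrA -mulrBl; apply/eqP.
    suff /dvdpXnP : 'X^(t.+1) %| (theta (eta_poly t.+1 0) - 'X * eta_poly t.+1 0) *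
      eta_monom t.+1 (lower ord0 a) by apply.
    by rewrite dvdp_mulr // theta_eta_poly0.
  rewrite coefXM; case: t {E} => [//|t] /=.
  exact: coef_eta_monom.
apply: eq_bigr => j _; rewrite coefZ; congr (_ * _).
rewrite theta_eta_polyS mulrBl coefB; congr (_ - _); last by rewrite coefCM.
by rewrite /eta_monom_coef eta_monom_raise.
Qed.

Definition eta_value j : R := limn (fun K => \sum_(t < K) eta_coef j t).

Lemma cvg_eta_value j : \sum_(t < K) eta_coef j t @[K --> \oo] --> eta_value j.
Proof.
apply: nondecreasing_is_cvgn.
  apply/nondecreasing_seqP => K; rewrite big_ord_recr /= lerDl; exact: eta_coef_ge0.
exists (2 ^ 5)%:R => _ [K _ <-].
apply: (@le_trans _ _ (\sum_(t < K) 1%:R ^+ (0 + t) / (0 + t)`!%:R)).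
  by apply: ler_sum => t _; rewrite expr1n mul1r eta_coef_le.
by apply: le_trans (exp_tail_le _ 1 0 K) _; rewrite expr0 divr1 mul1r.
Qed.

Lemma cvg_prod_finite (I : Type) (r : seq I) (F : I -> nat -> R) (f : I -> R) :
  (forall i, F i K @[K --> \oo] --> f i) ->
  \prod_(i <- r) F i K @[K --> \oo] --> \prod_(i <- r) f i.
Proof.
move=> Ff; elim: r => [|i r IHr].
  under eq_cvg do rewrite big_nil; rewrite big_nil; exact: cvg_cst.
under eq_cvg do rewrite big_cons; rewrite big_cons; exact: cvgM.
Qed.

Lemma horner1_eta_monom K a :
  (eta_monom K a).[1] = \prod_(j < n.+1) (\sum_(t < K) eta_coef j t) ^+ a j.
Proof.
rewrite horner_prod; apply: eq_bigr => j _; rewrite horner_exp horner_poly.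
by congr (_ ^+ _); apply: eq_bigr => t _; rewrite expr1n mulr1.
Qed.

Lemma cvg_horner1_eta_monom a :
  (eta_monom K a).[1] @[K --> \oo] --> \prod_(j < n.+1) eta_value j ^+ a j.
Proof.
under eq_cvg do rewrite horner1_eta_monom.
apply: cvg_prod_finite => j.
rewrite -[a j]card_ord -prodr_const; under eq_cvg do rewrite -prodr_const.
by apply: cvg_prod_finite => _; apply: cvg_eta_value.
Qed.

(** All coefficients are nonnegative, so longer truncations only increase those of the product. *)
Lemma coef_eta_monom_le K a t : (eta_monom K a)`_t <= eta_monom_coef a t.
Proof.
pose le p q := forall t, 0 <= p`_t <= q`_t.
have leM p q p' q' : le p q -> le p' q' -> le (p * p') (q * q').
  move=> pq pq' s; rewrite !coefM; apply/andP; split.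
    apply: sumr_ge0 => l _; apply: mulr_ge0.
      by have /andP[] := pq l.
    by have /andP[] := pq' (s - l)%N.
  apply: ler_sum => l _; have /andP[p0 p1] := pq l; have /andP[q0 q1] := pq' (s - l)%N.
  exact: ler_pM.
have le1 : le 1 1 by move=> s; rewrite lexx coef1 ler0n.
have leK : le (eta_monom K a) (eta_monom (K + t.+1) a).
  apply: (big_ind2 le) => // j _; rewrite -(card_ord (a j)) -!prodr_const.
  apply: (big_ind2 le) => // _ _ s; rewrite !coef_poly.
  have [lt_sK|le_Ks] := ltnP s K; first by rewrite ltn_addr // lexx eta_coef_ge0.
  by case: ifP => _; rewrite !lexx ?eta_coef_ge0.
have /andP[_] := leK t; rewrite [in leRHS]coef_eta_monom //.
by rewrite addnS ltnS leq_addl.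
Qed.

(** The partial sums [S] of the Cauchy product and the products [P] of partial sums interlace:
    [S K <= P K], and each [P K] is below some [S K']. Hence their limits agree. *)
Lemma cvg_eta_monom a :
  \sum_(t < K) eta_monom_coef a t @[K --> \oo] --> \prod_(j < n.+1) eta_value j ^+ a j.
Proof.
pose S K := \sum_(t < K) eta_monom_coef a t; pose P K := (eta_monom K a).[1].
set l := \prod_j _; have Pl : P K @[K --> \oo] --> l by exact: cvg_horner1_eta_monom.
have S_nd : nondecreasing_seq S.
  apply/nondecreasing_seqP => K; rewrite /S big_ord_recr /= lerDl.
  exact: eta_monom_coef_ge0.
have SP K : S K <= P K.
  rewrite /P (horner_coef_wide _ (leq_addr K _)) addnC big_split_ord /=.
  apply: (@le_trans _ _ (\sum_(t < K) (eta_monom K a)`_t * 1 ^+ t)).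
    by apply: ler_sum => t _; rewrite expr1n mulr1 coef_eta_monom.
  rewrite lerDl; apply: sumr_ge0 => t _; rewrite expr1n mulr1.
  by have /andP[] := egf_le_monom K a (K + t).
have PS K : exists K', P K <= S K'.
  exists (size (eta_monom K a)); rewrite /P horner_coef; apply: ler_sum => t _.
  by rewrite expr1n mulr1 coef_eta_monom_le.
have S_le K : S K <= l.
  apply: (cvgr_to_ge Pl); exists K => // L /= le_KL.
  exact: le_trans (S_nd _ _ le_KL) (SP L).
have S_cvg : cvgn S.
  by apply: nondecreasing_is_cvgn => //; exists l => _ [K _ <-].
suff -> : l = limn S by [].
apply/eqP; rewrite eq_le; apply/andP; split; last first.
  by apply: limr_le => //; near=> K.
apply: (cvgr_to_le Pl); near=> K; have [K' le_PS] := PS K.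
exact: le_trans le_PS (nondecreasing_cvgn_le S_nd S_cvg K').
Unshelve. all: by end_near.
Qed.

End Monomials.
End EtaSeries.

(** * The differential system of the monomials *)

Section EtaSystem.
Variables (R : realType) (n d : nat).
Implicit Types (a b : multinom n.+1) (j : 'I_n).

Local Notation M := #|{: bmultinom n.+1 d}|.
Local Notation I := 'I_M.

Definition expo (i : I) : multinom n.+1 := bmnm (enum_val i).

Definition mnm_shift (j : 'I_n) (a : multinom n.+1) : multinom n.+1 :=
  mnm_add (mnm_sub a (mnm1 (lift ord0 j))) (mnm1 (widen_ord (leqnSn n) j)).

Definition mnm_drop (j : 'I_n) (a : multinom n.+1) : multinom n.+1 :=
  mnm_sub a (mnm1 (lift ord0 j)).

Definition eta_mx : 'M[R]_M := \matrix_(i, i') \sum_(j < n)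
  (expo i (lift ord0 j))%:R *
  ((expo i' == mnm_shift j (expo i))%:R - (j == 0%N :> nat)%:R * (expo i' == mnm_drop j (expo i))%:R).

Definition eta_Y (i : I) (t : nat) : R := eta_monom_coef R (expo i) t.

Definition mnm_weight (a : multinom n.+1) := (\sum_(j < n.+1) j * a j)%N.

(** Trading [F_(j+1)] for [F_j] or 1 lowers the weight, which makes [eta_mx] strictly triangular;
    the index [i] breaks ties. *)
Definition eta_rank (i : I) := (mnm_weight (expo i) * M + i)%N.

Lemma expo_inj : injective expo.
Proof. by move=> i i' /val_inj/enum_val_inj. Qed.

Lemma expo_onto (a : multinom n.+1) : (mdeg a < d)%N -> exists i, expo i = a.
Proof.
by move=> lt_ad; exists (enum_rank (BMultinom lt_ad)); rewrite /expo enum_rankK.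
Qed.

Lemma mdeg_expo i : (mdeg (expo i) < d)%N.
Proof. exact: bmdeg. Qed.

Lemma sum_expo_eq (F : multinom n.+1 -> R) a : (mdeg a < d)%N ->
  \sum_i (expo i == a)%:R * F (expo i) = F a.
Proof.
move=> /expo_onto[i0 <-]; rewrite (bigD1 i0) //= eqxx mul1r big1 ?addr0 // => i ni.
by rewrite (inj_eq expo_inj) (negPf ni) mul0r.
Qed.

Lemma mdeg_drop j a : (mdeg (mnm_drop j a) <= mdeg a)%N.
Proof. exact: mdegB. Qed.

Lemma mnm_shiftK j a : a (lift ord0 j) != 0%N ->
  mnm_add (mnm_shift j a) (mnm1 (lift ord0 j)) = mnm_add a (mnm1 (widen_ord (leqnSn n) j)).
Proof.
move=> a0; apply/mnmP => i; rewrite !mnmDE !mnmBE !mnm1E.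
case: eqP => [<-|_]; last by rewrite subn0 addn0.
by move: a0; rewrite -lt0n; lia.
Qed.

Lemma mdeg_shift j a : a (lift ord0 j) != 0%N -> mdeg (mnm_shift j a) = mdeg a.
Proof.
by move=> /mnm_shiftK/(congr1 (@mdeg _)); rewrite !mdegD !mdeg1 => /addIn.
Qed.

Lemma mnm_weightD a b : mnm_weight (mnm_add a b) = (mnm_weight a + mnm_weight b)%N.
Proof. by rewrite -big_split; apply: eq_bigr => j _; rewrite mnmDE mulnDr. Qed.

Lemma mnm_weight1 (j : 'I_n.+1) : mnm_weight (mnm1 j) = j.
Proof.
rewrite /mnm_weight (bigD1 j) //= mnm1E eqxx muln1 big1 ?addn0 // => i ni.
by rewrite mnm1E eq_sym (negPf ni) muln0.
Qed.

Lemma mnm_weight_shift j a : a (lift ord0 j) != 0%N ->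
  (mnm_weight (mnm_shift j a)).+1 = mnm_weight a.
Proof.
move=> /mnm_shiftK/(congr1 mnm_weight); rewrite !mnm_weightD !mnm_weight1 lift0 /=.
lia.
Qed.

Lemma mnm_weight_drop j a : a (lift ord0 j) != 0%N ->
  (mnm_weight (mnm_drop j a) < mnm_weight a)%N.
Proof.
move=> a0; have E : mnm_add (mnm_drop j a) (mnm1 (lift ord0 j)) = a.
  by rewrite submK // lep1mP.
by rewrite -[X in (_ < mnm_weight X)%N]E mnm_weightD mnm_weight1 lift0 addnS ltnS leq_addr.
Qed.

Lemma eta_rank_inj : injective eta_rank.
Proof.
move=> i i' /(congr1 (modn^~ M)).
by rewrite /eta_rank !modnMDl !modn_small // => /val_inj.
Qed.

Lemma eta_mx_lower i i' : eta_mx i i' != 0 -> (eta_rank i' < eta_rank i)%N.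
Proof.
move=> Nii; suff lt_wt : (mnm_weight (expo i') < mnm_weight (expo i))%N.
  rewrite /eta_rank; apply: (@leq_trans ((mnm_weight (expo i')).+1 * M)).
    by rewrite mulSn addnC -addSn leq_add2r.
  by apply: leq_trans (leq_addr _ _); rewrite leq_mul2r lt_wt orbT.
apply: contraNT Nii; rewrite -leqNgt => le_wt; rewrite mxE big1 // => j _.
have [->|a0] := eqVneq (expo i (lift ord0 j)) 0%N; first by rewrite mul0r.
have [E|_] := eqVneq (expo i') (mnm_shift j (expo i)).
  by move: le_wt; rewrite E -(mnm_weight_shift a0) ltnn.
have [E|_] := eqVneq (expo i') (mnm_drop j (expo i)).
  by move: le_wt; rewrite E leqNgt mnm_weight_drop.
by rewrite mulr0 subr0 mulr0.
Qed.

Lemma eta_mx_int i i' : eta_mx i i' \is a Num.int.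
Proof.
rewrite mxE; apply: rpred_sum => j _; apply: rpredM; first exact: rpred_nat.
by apply: rpredB; [exact: rpred_nat|rewrite -natrM rpred_nat].
Qed.

Lemma eta_Y_rec i t : eta_Y i t *+ t =
  (expo i ord0)%:R * (if t is t'.+1 then eta_Y i t' else 0) + \sum_i' eta_mx i i' * eta_Y i' t.
Proof.
rewrite /eta_Y eta_monom_coef_rec; congr (_ + _).
under [RHS]eq_bigr do rewrite mxE mulr_suml.
rewrite exchange_big; apply: eq_bigr => j _ /=.
have [->|a0] := eqVneq (expo i (lift ord0 j)) 0%N.
  by rewrite mul0r big1 // => i' _; rewrite !mul0r.
under [RHS]eq_bigr do rewrite -mulrA mulrBl -mulrA.
rewrite -mulr_sumr sumrB -mulr_sumr; congr (_ * (_ - _ * _)).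
  rewrite (sum_expo_eq (fun a => eta_monom_coef R a t)) ?mdeg_shift ?mdeg_expo //.
  by apply: eq_eta_monom_coef => i'; rewrite /raise /lower mnmDE mnmBE !mnm1E [lift _ _ == _]eq_sym [widen_ord _ _ == _]eq_sym.
rewrite (sum_expo_eq (fun a => eta_monom_coef R a t)).
  by apply: eq_eta_monom_coef => i'; rewrite /lower mnmBE mnm1E eq_sym.
exact: leq_ltn_trans (mdeg_drop _ _) (mdeg_expo _).
Qed.

Lemma eta_Y0 i : (forall j, expo i (lift ord0 j) = 0%N) -> eta_Y i 0 = 1.
Proof.
move=> a0; rewrite /eta_Y /eta_monom_coef /eta_monom -horner_coef0 horner_prod.
rewrite big_ord_recl big1 => [|j _]; last by rewrite a0 expr0 hornerC.
by rewrite mulr1 horner_exp horner_coef0 coef_poly /= eta_coef00 expr1n.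
Qed.

(** Induction on [j]. If [F_(j+1)] occurs in a monomial [i] of the support, trade one such factor
    for [F_j] to get [b]. The exponent of [F_j] is constant on the support and one larger in [b], so
    among the rows of the support only [i] reaches column [b], and [(c N)_b] is nonzero. *)
Lemma eta_leading_support (c : 'rV[R]_M) m : c *m eta_mx = 0 ->
  (forall i, c 0 i != 0 -> expo i ord0 = m) ->
  forall j i, c 0 i != 0 -> expo i (lift ord0 j) = 0%N.
Proof.
move=> cN c_m j; have [s] := ubnP (j : nat); elim: s j => // s IHs j lt_js i ci.
apply/eqP; apply: contraT => aj0.
have low (l : 'I_n) i' : (l < j)%N -> c 0 i' != 0 -> expo i' (lift ord0 l) = 0%N.
  by move=> lt_lj; apply: IHs; apply: leq_trans lt_lj _.
pose w : 'I_n.+1 := widen_ord (leqnSn n) j.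
have same i' : c 0 i' != 0 -> expo i' w = expo i w.
  move=> ci'; case: (unliftP ord0 w) => [l wE|->]; last by rewrite !c_m.
  by rewrite wE !low //; have := congr1 val wE; rewrite /= /bump leq0n add1n => ->.
pose b := mnm_shift j (expo i).
have [ib ibE] : exists ib, expo ib = b.
  by apply: expo_onto; rewrite mdeg_shift ?mdeg_expo.
have w_lift (l : 'I_n) : (j <= l)%N -> (lift ord0 l == w) = false.
  by move=> le_jl; apply/eqP => /(congr1 val); rewrite /= /bump leq0n add1n => E; move: le_jl; rewrite -E ltnn.
have bw : b w = (expo i w).+1.
  by rewrite /b mnmDE mnmBE !mnm1E eqxx w_lift // subn0 addn1.
have entry i' : c 0 i' != 0 -> eta_mx i' ib = (i' == i)%:R * (expo i (lift ord0 j))%:R.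
  move=> ci'; rewrite mxE ibE (bigD1 j) //= big1 ?addr0 => [|l nlj].
    have [a0|a0] := eqVneq (expo i' (lift ord0 j)) 0%N.
      rewrite a0 mul0r; have [E|_] := eqVneq i' i; last by rewrite mul0r.
      by move: aj0; rewrite -E a0.
    have -> : (b == mnm_drop j (expo i')) = false.
      apply/eqP => /(congr1 (fun u : multinom _ => u w)).
      by rewrite bw mnmBE same // => E; move: (leq_subr (mnm1 (lift ord0 j) w) (expo i w)); rewrite -E ltnn.
    have -> : (b == mnm_shift j (expo i')) = (i' == i).
      apply/eqP/eqP => [E|->//]; apply/expo_inj/(@addIm _ (mnm1 w)).
      by rewrite -!mnm_shiftK // -/b E.
    rewrite mulr0 subr0 mulrC; case: eqP => [->//|_]; by rewrite !mul0r.
  have [->|a0] := eqVneq (expo i' (lift ord0 l)) 0%N; first by rewrite mul0r.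
  have lt_jl : (j < l)%N.
    rewrite ltn_neqAle eq_sym (inj_eq val_inj) nlj leqNgt /=.
    by apply: contra_neqN a0 => lt_lj; rewrite low.
  have -> : (b == mnm_drop l (expo i')) = false.
    apply/eqP => /(congr1 (fun u : multinom _ => u w)).
    by rewrite bw mnmBE same // => E; move: (leq_subr (mnm1 (lift ord0 l) w) (expo i w)); rewrite -E ltnn.
  have -> : (b == mnm_shift l (expo i')) = false.
    apply/eqP => /(congr1 (fun u : multinom _ => u w)).
    rewrite bw mnmDE mnmBE !mnm1E same // w_lift ?subn0; last exact: ltnW.
    case: eqP => [/(congr1 val) /= /val_inj E|_]; first by rewrite E ltnn in lt_jl.
    by rewrite addn0 => /esym/n_Sn.
  by rewrite mulr0 subr0 mulr0.
have := congr1 (fun u : 'rV_M => u 0 ib) cN; rewrite !mxE (bigD1 i) //= big1 => [|i' ni'].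
  rewrite addr0 entry // eqxx mul1r => /eqP; rewrite mulf_eq0 (negPf ci) pnatr_eq0 /=.
  by rewrite (negPf aj0).
have [->|ci'] := eqVneq (c 0 i') 0; first by rewrite mul0r.
by rewrite entry // (negPf ni') mul0r mulr0.
Qed.

(** The support reduces to the single monomial [F_0^m], whose value at 0 is 1. *)
Lemma eta_leading (c : 'rV[R]_M) m : c != 0 -> c *m eta_mx = 0 ->
  (forall i, c 0 i != 0 -> expo i ord0 = m) -> \sum_i c 0 i * eta_Y i 0 != 0.
Proof.
move=> c0 cN c_m; have c_supp := eta_leading_support cN c_m.
have [i0 ci0] := rV0Pn _ c0; rewrite (bigD1 i0) //= big1 ?addr0 => [|i ni].
  by rewrite eta_Y0 ?mulr1 // => j; apply: c_supp.
have [->|ci] := eqVneq (c 0 i) 0; first by rewrite mul0r.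
case/eqP: ni; apply/expo_inj/mnmP => j.
by case: (unliftP ord0 j) => [l|] ->; rewrite ?c_m ?c_supp.
Qed.

End EtaSystem.

Theorem eta_values_independent (R : realType) n (q : mpoly n.+1 R) :
  (forall a, mcoeff a q \is a Num.int) ->
  meval (fun j : 'I_n.+1 => eta_value R j) q = 0 -> q = 0.
Proof.
(* Degrees below [d] cover the monomials of [q] and, thanks to the added 2, the distinct monomials 1
   and [F_0], so that [1 < M]. *)
move=> q_int q0; pose d := (msize q + 2)%N.
have d1 : (1 < d)%N by rewrite /d addn2.
pose M := #|{: bmultinom n.+1 d}|.
pose c : 'rV[R]_M := \row_i mcoeff (expo i) q.
pose y (i : 'I_M) : R := \prod_(j < n.+1) eta_value R j ^+ expo i j.
have [i0 i0E] : exists i : 'I_M, expo i = mnm0 by apply: expo_onto; rewrite mdeg0 ltnW.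
have [i1 i1E] : exists i : 'I_M, expo i = mnm1 ord0 by apply: expo_onto; rewrite mdeg1.
have M1 : (1 < M)%N.
  rewrite ltnNge; apply/negP => M_le1; have i01 : i0 = i1.
    apply/val_inj/eqP => /=.
    have := leq_trans (ltn_ord i0) M_le1; have := leq_trans (ltn_ord i1) M_le1.
    by rewrite !ltnS !leqn0 => /eqP-> /eqP->.
  have := i1E; rewrite -i01 i0E => /(congr1 (fun u : multinom _ => u ord0)).
  by rewrite mnm0E mnm1E eqxx.
have sum_expo (i : 'I_M) : (\sum_j expo i j <= d)%N by rewrite -mdegE ltnW ?mdeg_expo.
(* With a common multiple [k <= 16 ^ T] of [1, ..., T], fewer than [d] factors of index at most [n]
   are cleared by [k ^ (d * n)]. *)
have Y_den T : exists2 e : nat, (0 < e <= (16 ^ (d * n)) ^ T)%N &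
    forall (i : 'I_M) t, (t <= T)%N -> e%:R * (t`!%:R * eta_Y R i t) \is a Num.int.
  have [k /andP[k0 k_le] kP] := exists_small_common_multiple T.
  exists (k ^ (d * n))%N; last by move=> i t le_tT; apply: eta_monom_coef_int le_tT.
  rewrite expn_gt0 k0 -expnM [(d * n * T)%N]mulnC (expnM 16 T) /=.
  by have [dn0|dn0] := posnP (d * n); [rewrite dn0 | rewrite leq_exp2r].
have cy : c *m (\col_i y i) = 0.
  apply/rowP => j; rewrite !mxE -[RHS]q0 /meval (@mmapE _ _ _ _ _ _ d); last by rewrite leq_addr.
  transitivity (\sum_(a in {: bmultinom n.+1 d})
      mcoeff a q * mmap1 (fun j : 'I_n.+1 => eta_value R j) a); last exact: eq_bigl.
  by rewrite [RHS]big_enum_val; apply: eq_bigr => i _; rewrite !mxE.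
have c0 : c = 0.
  apply: (integer_relation_trivial (y := y) (b0 := i0) (@eta_Y_rec R n d) _ _ (@eta_rank_inj n d)
    (@eta_mx_lower R n d) (@eta_mx_int R n d) (@eta_leading R n d) (ltnW d1) _ Y_den M1 _ _ _ cy).
  - by move=> i t; apply: eta_monom_coef_le.
  - by move=> i; apply: cvg_eta_monom.
  - by rewrite expn_gt0.
  - by rewrite eta_Y0 ?oner_eq0 // => j; rewrite i0E mnm0E.
  - by rewrite /y big1 // => j _; rewrite i0E mnm0E expr0.
  - by move=> i; rewrite mxE.
apply/mpolyP => a; rewrite mcoeff0.
have [lt_ad|le_da] := ltnP (mdeg a) d; last first.
  by apply: memN_msupp_eq0; apply: msize_mdeg_ge; apply: leq_trans le_da; rewrite leq_addr.
have [i <-] := expo_onto lt_ad.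
by have /rowP/(_ i) := c0; rewrite !mxE.
Qed.

(** * From rational to algebraic coefficients *)

Section AlgebraicFamilies.
Variable L : numFieldType.
Local Notation Q := (ratr : rat -> L).

(** Multiplication by [x] acts on the rational span of [beta] by a rational matrix; such actions
    stand for the number field generated by the coefficients. *)
Definition stabilizes (I : finType) (beta : I -> L) (x : L) :=
  exists C : I -> I -> rat, forall i, x * beta i = \sum_j Q (C i j) * beta j.

(** To add a root [x] of [p], pass to the products [beta i * x ^ l] with [l < deg p]: powers of [x]
    reduce modulo [p], and the earlier elements act on the first factor. *)
Lemma exists_stable_family (s : seq L) :
  (forall x, x \in s -> algebraicOver Q x) ->
  exists (I : finType) (beta : I -> L),
    (exists i, beta i != 0) /\ forall x, x \in s -> stabilizes beta x.
Proof.
elim: s => [|x s IHs] s_alg.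
  by exists unit, (fun=> 1); split; [exists tt; rewrite oner_neq0|].
have [z zs|I [beta [[i0 bi0] beta_s]]] := IHs; first by apply: s_alg; rewrite in_cons zs orbT.
have [p p0 /rootP px] := s_alg x (mem_head _ _).
pose e := (size p).-1.
have e0 : (0 < e)%N.
  rewrite /e -subn1 subn_gt0 ltnNge; apply/negP => /size1_polyC pC; move: px p0.
  by rewrite pC map_polyC hornerC => /eqP; rewrite fmorph_eq0 polyC_eq0 => ->.
have red k : x ^+ k = \sum_(l < e) Q (modp 'X^k p)`_l * x ^+ l.
  have sr : (size (map_poly Q (modp 'X^k p)) <= e)%N.
    by rewrite size_map_poly -ltnS /e prednK ?size_poly_gt0 // ltn_modp.
  transitivity (map_poly Q (modp 'X^k p)).[x].
    have /(congr1 (fun u => (map_poly Q u).[x])) := divp_eq 'X^k p.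
    by rewrite rmorphD rmorphM /= map_polyXn hornerXn hornerD hornerM px mulr0 add0r.
  by rewrite (horner_coef_wide _ sr); apply: eq_bigr => l _; rewrite coef_map.
exists (I * 'I_e)%type, (fun a : I * 'I_e => beta a.1 * x ^+ a.2); split.
  by exists (i0, Ordinal e0); rewrite /= expr0 mulr1.
move=> y; rewrite in_cons => /predU1P[->|ys].
  exists (fun a b : I * 'I_e => (a.1 == b.1)%:R * (modp 'X^(a.2.+1) p)`_b.2) => -[i j] /=.
  rewrite -(pair_bigA _ (fun (i' : I) (l : 'I_e) => Q ((i == i')%:R * (modp 'X^(j.+1) p)`_l) * (beta i' * x ^+ l))) /=.
  rewrite (bigD1 i) //= [X in _ + X]big1 ?addr0 => [|i' ni']; last first.
    by apply: big1 => l _; rewrite eq_sym (negPf ni') mul0r rmorph0 mul0r.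
  rewrite mulrCA -exprS red mulr_sumr; apply: eq_bigr => l _.
  by rewrite eqxx mul1r mulrCA.
have [C CE] := beta_s y ys.
exists (fun a b : I * 'I_e => C a.1 b.1 * (a.2 == b.2)%:R) => -[i j] /=.
rewrite -(pair_bigA _ (fun (i' : I) (l : 'I_e) => Q (C i i' * (j == l)%:R) * (beta i' * x ^+ l))) /=.
rewrite mulrA CE mulr_suml; apply: eq_bigr => i' _.
rewrite (bigD1 j) //= [X in _ + X]big1 ?addr0 => [|l nl]; last first.
  by rewrite eq_sym (negPf nl) mulr0 rmorph0 mul0r.
by rewrite eqxx mulr1 mulrA.
Qed.

(** A stable family of least size with a nonzero member is independent: a relation would express one
    member by the others, which would form a smaller such family. *)
Lemma exists_independent_stable_family (s : seq L) :
  (forall x, x \in s -> algebraicOver Q x) ->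
  exists n (beta : 'I_n -> L),
    [/\ exists i, beta i != 0, forall x, x \in s -> stabilizes beta x &
      forall w : 'I_n -> rat, \sum_i Q (w i) * beta i = 0 -> forall i, w i = 0].
Proof.
move=> s_alg.
pose good n := `[< exists beta : 'I_n -> L,
  (exists i, beta i != 0) /\ forall x, x \in s -> stabilizes beta x >].
have ex_good : exists n, good n.
  have [I [beta [[i0 bi0] beta_s]]] := exists_stable_family s_alg.
  exists #|I|; apply/asboolP; exists (fun i => beta (enum_val i)); split.
    by exists (enum_rank i0); rewrite enum_rankK.
  move=> x /beta_s[C CE]; exists (fun i j => C (enum_val i) (enum_val j)) => i.
  rewrite CE; transitivity (\sum_(j in I) Q (C (enum_val i) j) * beta j).
    exact: eq_bigl.
  by rewrite big_enum_val.
have [n /asboolP[beta [[i0 bi0] beta_s]] n_min] := ex_minnP ex_good.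
exists n, beta; split=> // [|w w0]; first by exists i0.
apply: contrapT => /existsNP[j /eqP wj].
case: n => [|n] in beta i0 bi0 beta_s n_min w w0 j wj *; first by have := ltn_ord j.
pose r k := - w (lift j k) / w j.
have bj : beta j = \sum_k Q (r k) * beta (lift j k).
  apply: (mulfI (_ : Q (w j) != 0)); first by rewrite fmorph_eq0.
  move: w0; rewrite (bigD1_ord j) //= => /eqP; rewrite addr_eq0 => /eqP ->.
  rewrite -sumrN mulr_sumr; apply: eq_bigr => k _.
  by rewrite mulrA -rmorphM /r [w j * _]mulrC divfK // rmorphN mulNr.
have : good n; last by move/n_min; rewrite ltnn.
apply/asboolP; exists (fun k => beta (lift j k)); split.
  apply: contrapT => /forallNP b0; case/eqP: bi0.
  have b0' k : beta (lift j k) = 0 by apply/eqP; apply: contrapT => /negP; apply: b0.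
  case: (unliftP j i0) => [k|] ->; first exact: b0'.
  by rewrite bj big1 // => k _; rewrite b0' mulr0.
move=> x /beta_s[C CE].
exists (fun k l => C (lift j k) (lift j l) + C (lift j k) j * r l) => k.
rewrite CE (bigD1_ord j) //= {1}bj mulr_sumr -big_split; apply: eq_bigr => l _ /=.
by rewrite rmorphD rmorphM; ring.
Qed.

End AlgebraicFamilies.

(* Multiplication by [p] on the number field generated by its coefficients is a
   matrix over the rational polynomials; it kills [beta] at [v], so its
   determinant, the norm of [p], vanishes at [v] and hence identically. *)
Lemma algebraic_relation_trivial (L : numFieldType) m (v : 'I_m -> L) (p : mpoly m L) :
  (forall q : mpoly m rat, mmap (ratr : rat -> L) v q = 0 -> q = 0) ->
  (forall u, algebraicOver (ratr : rat -> L) (mcoeff u p)) -> meval v p = 0 -> p = 0.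
Proof.
set Q := (ratr : rat -> L) => indep p_alg pv.
have [|n [beta [[i0 bi0] beta_s beta_free]]] :=
    @exists_independent_stable_family L [seq mcoeff u p | u <- msupp p].
  by move=> x /mapP[u _ ->].
have /choice[C CE] u : exists C : 'I_n -> 'I_n -> rat,
    forall i, mcoeff u p * beta i = \sum_j Q (C i j) * beta j.
  have [u_supp|/memN_msupp_eq0 ->] := boolP (u \in msupp p).
    by apply/beta_s/mapP; exists u.
  exists (fun _ _ => 0) => i; rewrite mul0r big1 // => j _.
  by rewrite /Q rmorph0 mul0r.
pose d := msize p.
pose P : 'M[mpoly m rat]_n :=
  \matrix_(i, j) \sum_(u : bmultinom m d) C u i j *: mpolyX rat u.
have detP : \det P = 0.
  apply: indep; rewrite -[LHS](det_map_mx (mmap Q v)).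
  set PV := map_mx _ P.
  have PV0 : PV *m (\col_i beta i) = 0.
    apply/colP => i; rewrite !mxE.
    transitivity (\sum_j \sum_(u : bmultinom m d) mmap1 v u * (Q (C u i j) * beta j)).
      apply: eq_bigr => j _; rewrite !mxE raddf_sum mulr_suml; apply: eq_bigr => u _.
      by rewrite /= mmapZ mmapX mulrAC mulrC.
    rewrite exchange_big /=; under eq_bigr do rewrite -mulr_sumr -CE mulrCA mulrA.
    rewrite -mulr_suml -[RHS](mul0r (beta i)); congr (_ * _).
    by rewrite -[RHS]pv /meval (@mmapE _ _ _ _ _ _ d).
  have /colP/(_ i0) : \det PV *: (\col_i beta i) = 0.
    by rewrite -mul_scalar_mx -mul_adj_mx -mulmxA PV0 mulmx0.
  by rewrite !mxE => /eqP; rewrite mulf_eq0 (negPf bi0) orbF => /eqP.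
have /det0P[w w0 wP] : \det P == 0 by rewrite detP.
(* The left kernel vector [w] turns the relations [betaP] into [F * p = 0], and independence of
   [beta] makes [F] nonzero. *)
pose F : mpoly m L := \sum_i beta i *: map_mpoly Q (w 0 i).
have betaP i : beta i *: p = \sum_j beta j *: map_mpoly Q (P i j).
  rewrite [p in LHS](mpolywE (leqnn _)) -/d scaler_sumr.
  under [RHS]eq_bigr do rewrite mxE (raddf_sum (map_mpoly Q)) scaler_sumr.
  rewrite exchange_big /=; apply: eq_bigr => u _.
  under [RHS]eq_bigr do rewrite map_mpolyZ map_mpolyX scalerA mulrC.
  by rewrite -scaler_suml -CE scalerA mulrC.
have pF : F * p = 0.
  transitivity (\sum_i map_mpoly Q (w 0 i) * (beta i *: p)).
    by rewrite mulr_suml; apply: eq_bigr => i _; rewrite -scalerAl -scalerAr.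
  under eq_bigr do rewrite betaP mulr_sumr.
  rewrite exchange_big big1 // => j _; under eq_bigr do rewrite -scalerAr -rmorphM.
  rewrite -scaler_sumr -raddf_sum; have /rowP/(_ j) := wP; rewrite !mxE => ->.
  by rewrite raddf0 scaler0.
have /eqP := pF; rewrite mulf_eq0 => /orP[/eqP F0|/eqP//].
case/rV0Pn: w0 => i; apply: contraNeq => _; apply/eqP/mpolyP => u; rewrite mcoeff0.
apply: (beta_free (fun i => mcoeff u (w 0 i))).
have := congr1 (mcoeff u) F0; rewrite raddf_sum mcoeff0 => E; rewrite -[RHS]E.
by apply: eq_bigr => j _; rewrite /= mcoeffZ mcoeff_map_mpoly mulrC.
Qed.

(** * The eta constants *)

(** The constants are summed from 1 and [eta_value] from 0; the extra term is 1 for [j = 0] and the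
    default value 0 otherwise. *)
Lemma eta_tildeE (R : realType) j :
  eta_tilde R j = - (j`!%:R * (eta_value R j - (j == 0%N)%:R)).
Proof.
rewrite /eta_tilde; congr (- (_ * _)).
have c0 : eta_coef R j 0 = (j == 0%N)%:R.
  by case: j => [|j]; rewrite ?eta_coef00 ?eta_coefS0.
apply: (@cvg_lim R) => //; rewrite -cvg_shiftS.
rewrite (_ : [sequence _]_n = fun K => \sum_(t < K.+1) eta_coef R j t - (j == 0%N)%:R).
  apply: cvgB; last exact: cvg_cst.
  by rewrite (cvg_shiftS (fun K => \sum_(t < K) eta_coef R j t)); apply: cvg_eta_value.
apply/funext => K /=; rewrite big_ord_recl c0 addrAC subrr add0r.
by rewrite big_add1 big_mkord.
Qed.

Lemma mmap_mmap_mpolyC (K : nzRingType) (S : comNzRingType) m n (f : {rmorphism K -> S})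
    (h : 'I_n -> S) (lq : 'I_m -> mpoly n K) (q : mpoly m K) :
  mmap f h (mmap (@mpolyC n K) lq q) = mmap f (fun j => mmap f h (lq j)) q.
Proof.
rewrite [X in mmap f h X]/mmap raddf_sum; apply: eq_bigr => u _ /=.
rewrite rmorphM /= mmapC; congr (_ * _).
by rewrite /mmap1 rmorph_prod; apply: eq_bigr => j _; rewrite rmorphXn.
Qed.

Lemma mmap_mpolyC_id (K : comNzRingType) m (q : mpoly m K) :
  mmap (@mpolyC m K) (fun j => mpolyX K (mnm1 j)) q = q.
Proof.
rewrite [RHS]mpolyE /mmap; apply: eq_bigr => u _.
by rewrite mmap1_id mul_mpolyC.
Qed.

Lemma meval_map_mpoly (K : nzRingType) (S : comNzRingType) m (f : {rmorphism K -> S})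
    (v : 'I_m -> S) (q : mpoly m K) : meval v (map_mpoly f q) = mmap f v q.
Proof.
rewrite {1}[q](mpolywE (leqnn _)) (raddf_sum (map_mpoly f)) (raddf_sum (meval v)) (@mmapE _ _ _ _ _ _ (msize q)) //.
by apply: eq_bigr => u _; rewrite /= map_mpolyZ map_mpolyX mevalZ mevalX.
Qed.

Lemma exists_denominator m (q : mpoly m rat) :
  exists2 D : int, D != 0 & forall u, D%:~R * mcoeff u q \is a Num.int.
Proof.
exists (\prod_(u <- msupp q) denq (mcoeff u q)).
  by rewrite prodf_seq_neq0; apply/allP => u _; rewrite denq_neq0.
move=> u; have [u_supp|/memN_msupp_eq0 ->] := boolP (u \in msupp q); last by rewrite mulr0 rpred0.
rewrite (big_rem u) //= rmorphM /= mulrAC rpredM ?rpred_int // mulrC.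
by rewrite -numqE rpred_int.
Qed.

(** The constants are invertible rational affine images of distinct eta values, so a relation among
    them becomes a relation [G] among the values, made integral by a common denominator. *)
Lemma rational_relation_trivial (R : realType) m (s : 'I_m -> nat) (q : mpoly m rat) :
  injective s -> mmap (ratr : rat -> R) (fun j => eta_tilde R (s j)) q = 0 -> q = 0.
Proof.
move=> s_inj q0; pose n := (\max_j s j)%N.
have s_le j : (s j < n.+1)%N by rewrite ltnS leq_bigmax.
pose idx j : 'I_n.+1 := Ordinal (s_le j).
pose z j : rat := (s j == 0%N)%:R.
pose lq j : mpoly n.+1 rat :=
  mpolyC n.+1 (- (s j)`!%:R) * (mpolyX rat (mnm1 (idx j)) - mpolyC n.+1 (z j)).
pose G := mmap (@mpolyC n.+1 rat) lq q.
have G_val : mmap (ratr : rat -> R) (fun i : 'I_n.+1 => eta_value R i) G = 0.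
  rewrite mmap_mmap_mpolyC -[RHS]q0; congr (mmap _ _ q); apply/funext => j.
  rewrite rmorphM rmorphB /= !mmapC mmapX mmap1U eta_tildeE.
  by rewrite /= rmorphN !rmorph_nat mulNr.
have G0 : G = 0.
  have [D D0 D_int] := exists_denominator G.
  have GD : map_mpoly (ratr : rat -> R) (D%:~R *: G) = 0.
    apply: eta_values_independent => [u|].
      rewrite mcoeff_map_mpoly mcoeffZ.
      by have /intrP[x ->] := D_int u; rewrite /= ratr_int rpred_int.
    by rewrite meval_map_mpoly mmapZ G_val mulr0.
  move/mpolyP: GD => GD.
  apply/mpolyP => u; move: (GD u); rewrite mcoeff_map_mpoly mcoeffZ !mcoeff0 => /eqP.
  by rewrite fmorph_eq0 mulf_eq0 intr_eq0 (negPf D0) => /eqP.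
(* A left inverse of the substitution [lq]; variables outside the image of [idx] are sent to 0. *)
pose hinv (i : 'I_n.+1) : mpoly m rat :=
  if [pick j | idx j == i] is Some j then
    mpolyC m (- (s j)`!%:R^-1) * mpolyX rat (mnm1 j) + mpolyC m (z j) else 0.
rewrite -[q]mmap_mpolyC_id -[RHS](raddf0 (mmap (@mpolyC m rat) hinv)) -G0.
transitivity (mmap (@mpolyC m rat) (fun j => mmap (@mpolyC m rat) hinv (lq j)) q); last first.
  exact/esym/mmap_mmap_mpolyC.
congr (mmap _ _ q); apply/funext => j.
rewrite rmorphM rmorphB /= !mmapC mmapX mmap1U /hinv.
case: pickP => [j' /eqP/(congr1 val)/= /s_inj ->|/(_ j)]; last by rewrite eqxx.
rewrite addrK mulrA -mpolyCM mulrNN divff ?mpolyC1 ?mul1r //.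
by rewrite pnatr_eq0 -lt0n fact_gt0.
Qed.

Theorem theorem4 (R : realType) :
  algebraically_independent_family (@algebraic_number R[i]%C)
    (fun n : nat => real_complex R (eta_tilde R n)) /\
  (forall n : nat, transcendental (eta_tilde R n)).
Proof.
have indep : algebraically_independent_family (@algebraic_number R[i]%C)
    (fun n : nat => real_complex R (eta_tilde R n)).
  move=> m s s_inj p p_alg pv; apply: (algebraic_relation_trivial _ p_alg pv) => q qv.
  apply: (@rational_relation_trivial R _ s) => //.
  apply: (fmorph_inj (real_complex R)); rewrite rmorph0 -[RHS]qv rmorph_sum.
  apply: eq_bigr => u _; rewrite rmorphM /= fmorph_rat; congr (_ * _).
  by rewrite /mmap1 rmorph_prod; apply: eq_bigr => j _; rewrite rmorphXn.
split=> // n [p p0 pr].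
pose a := real_complex R (eta_tilde R n).
have a_alg : algebraicOver (ratr : rat -> R[i]%C) a.
  exists p => //; move: pr; rewrite -(fmorph_root (real_complex R)) -map_poly_comp.
  by rewrite (eq_map_poly (g := ratr)) // => x; rewrite /= fmorph_rat.
have alg_nat k : algebraicOver (ratr : rat -> R[i]%C) k%:R.
  by rewrite -[X in algebraicOver _ X](ratr_nat _ k); apply: algebraic_id.
have s_inj : injective (fun _ : 'I_1 => n) by move=> i j _; rewrite !ord1.
(* If the constant [a] were algebraic, [X - a] would be a nontrivial relation in one variable. *)
pose P : mpoly 1 R[i]%C := mpolyX _ (mnm1 ord0) - mpolyC 1 a.
have P0 : P = 0.
  apply: (indep 1%N _ s_inj).
    move=> u; rewrite /algebraic_number mcoeffB mcoeffX mcoeffC.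
    apply: algebraic_sub; last apply: algebraic_mul => //; apply: alg_nat.
  by rewrite mevalB mevalC mevalXU subrr.
have := congr1 (mcoeff (mnm1 ord0)) P0.
rewrite mcoeffB mcoeffX mcoeffC eqxx mcoeff0 mnm1_eq0 mulr0 subr0 => /eqP.
by rewrite oner_eq0.
Qed.
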